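(* Let $m\geq3$ be odd. For $i\in\{1,2\}$, let $(T_i,\psi_i)$ be a good $C_m$-gluing template, let $J_i=J(T_i,\psi_i)$, and let $H_i$ be obtained from $J_i$ by deleting $\ell_i\geq0$ connected components with exactly two vertices and an arbitrary number of connected components with exactly one vertex. Suppose $e(H_i)\geq m$ for $i\in\{1,2\}$, and let $p_1,p_2\in(0,1)$ with $p_1+p_2=1$ satisfy \[\frac{e(H_1)+\ell_1}{e(H_1)p_1^{m-1}}=\frac{e(H_2)+\ell_2}{e(H_2)p_2^{m-1}}.\] Then $(H_1,H_2)$ is $(p_1,p_2)$-common.
   Context: Graphs are finite and simple; $e(\cdot)$ counts edges; $C_m$ is the $m$-cycle. An $F$-gluing template is a pair $(T,\psi)$ where $T$ is a finite tree and $\psi:V(T)\cup E(T)\to 2^{V(F)}$ satisfies $\psi(st)\subseteq\psi(s)\cap\psi(t)$ for every edge $st$ of $T$. The graph $J(T,\psi)$ is obtained by taking, for each $s\in V(T)$, a copy $F_s$ of the induced subgraph $F[\psi(s)]$, and then, for each edge $st\in E(T)$ and each $v\in\psi(st)$, identifying the vertex of $F_s$ corresponding to $v$ with that of $F_t$ corresponding to $v$. For $S_1,S_2\subseteq V(F)$ write $S_1\sim_F S_2$ if some automorphism $\varphi$ of $F$ has $\varphi(S_1)=S_2$. Consider the real vector space with a basis vector for each $\sim_F$-class of nonempty subsets of $V(F)$; for $S\subseteq V(F)$ let $\vec e_S$ be the basis vector of the class of $S$ if $S\neq\emptyset$, and $\vec e_\emptyset=\vec 0$. Define $\vec z_{T,\psi}:=\sum_{s\in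 V(T)}\vec e_{\psi(s)}-\sum_{st\in E(T)}\vec e_{\psi(st)}$ and, for pairwise disjoint $R_1,R_2,R_3\subseteq V(F)$, $\vec x_{R_1,R_2,R_3}:=\vec e_{R_1\cup R_2\cup R_3}-\vec e_{R_2\cup R_3}-\vec e_{R_1\cup R_2}+\vec e_{R_2}$. The template is good if $e(J(T,\psi))>0$ and $(e(J)/e(F))\vec e_{V(F)}-\vec z_{T,\psi}$ is a non-negative linear combination of the vectors $\vec x_{R_1,R_2,R_3}$. A graphon is a symmetric measurable $W:[0,1]^2\to[0,1]$, and $t(H,W):=\int_{[0,1]^{V(H)}}\prod_{uv\in E(H)}W(x_u,x_v)\prod_{v}dx_v$. For $p_1,p_2\in(0,1)$ with $p_1+p_2=1$, a pair $(H_1,H_2)$ of graphs with at least one edge each is $(p_1,p_2)$-common if for all graphons $W_1,W_2$ with $W_1+W_2=1$, \[\frac{t(H_1,W_1)}{e(H_1)p_1^{e(H_1)-1}}+\frac{t(H_2,W_2)}{e(H_2)p_2^{e(H_2)-1}}\geq \frac{p_1}{e(H_1)}+\frac{p_2}{e(H_2)}.\] *)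

(* Defs.v *)
From HB Require Import structures.
From mathcomp Require Import all_boot all_order all_algebra all_fingroup.
From mathcomp Require Import all_classical all_reals all_analysis.

Set Implicit Arguments.
Unset Strict Implicit.
Unset Printing Implicit Defensive.

Import Order.TTheory GRing.Theory Num.Theory.
Import numFieldNormedType.Exports.

Local Open Scope ring_scope.

Record sgraph := SGraph {
  vertex :> finType;
  adj : rel vertex;
  adj_sym : symmetric adj;
  adj_irrefl : irreflexive adj }.

Definition edges (G : sgraph) : {set {set G}} :=
  [set [set p.1; p.2] | p in [pred p : G * G | adj p.1 p.2]].

Definition nedges (G : sgraph) : nat := #|edges G|.

Definition components (G : sgraph) : {set {set G}} :=
  equivalence_partition (connect (@adj G)) [set: G].

(* A [ucycle] of size at most 2 is not a cycle of the graph: [:: x; y] is one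
   as soon as x and y are adjacent. *)
Definition is_tree (G : sgraph) : Prop :=
  [/\ (0 < #|G|)%N,
      (forall x y : G, connect (@adj G) x y) &
      (forall c : seq G, ucycle (@adj G) c -> (size c <= 2)%N)].

Definition isomorphic (G H : sgraph) : Prop :=
  exists2 f : G -> H, bijective f & forall x y, adj (f x) (f y) = adj x y.

Definition automorphism (G : sgraph) (f : {perm G}) : bool :=
  [forall x, forall y, adj (f x) (f y) == adj x y].

Section InducedSubgraph.
Variables (G : sgraph) (A : {set G}).

Definition induced_adj : rel {x : G | x \in A} :=
  fun x y => adj (val x) (val y).

Fact induced_sym : symmetric induced_adj.
Proof. by move=> x y; exact: adj_sym. Qed.

Fact induced_irrefl : irreflexive induced_adj.
Proof. by move=> x; exact: adj_irrefl. Qed.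

Definition induced : sgraph := SGraph induced_sym induced_irrefl.
End InducedSubgraph.

Definition delete_components (J : sgraph) (D : {set {set J}}) : sgraph :=
  induced (~: finset.cover D).

Definition obtained_by_deletion (J : sgraph) (l : nat) (H : sgraph) : Prop :=
  exists D2 D1 : {set {set J}},
    [/\ D2 \subset [set C in components J | #|C| == 2],
        #|D2| = l,
        D1 \subset [set C in components J | #|C| == 1] &
        isomorphic H (delete_components (D2 :|: D1))].

Section CycleGraph.
Variable m : nat.

(* The guard i != j only matters for m = 1. *)
Definition cycle_adj : rel 'I_m := fun i j =>
  (i != j) && ((j == i.+1 %% m :> nat) || (i == j.+1 %% m :> nat))%N.

Fact cycle_sym : symmetric cycle_adj.
Proof. by move=> i j; rewrite /cycle_adj eq_sym orbC. Qed.

Fact cycle_irrefl : irreflexive cycle_adj.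
Proof. by move=> i; rewrite /cycle_adj eqxx. Qed.

Definition cycle_graph : sgraph := SGraph cycle_sym cycle_irrefl.
End CycleGraph.

(* The map psi is split into its restrictions to V(T) and to E(T); only the
   values of [psiE] on [edges tree] are ever used. *)
Record template (F : sgraph) := Template {
  tree : sgraph;
  treeP : is_tree tree;
  psiV : tree -> {set F};
  psiE : {set tree} -> {set F};
  psi_sub : forall s t : tree, adj s t ->
    psiE [set s; t] \subset psiV s :&: psiV t }.
Arguments psiV {F} _ _.
Arguments psiE {F} _ _.

Section GluedGraph.
Variables (F : sgraph) (P : template F).

(* The pair (s, v) stands for the vertex of F_s corresponding to v. *)
Definition copies : {set tree P * F} := [set p | p.2 \in psiV P p.1].

Definition identified : rel (tree P * F) := fun p q =>
  [&& adj p.1 q.1, p.2 == q.2 & p.2 \in psiE P [set p.1; q.1]].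

Definition glued_classes : {set {set tree P * F}} :=
  equivalence_partition (connect identified) copies.

Definition glued_adj : rel {A : {set tree P * F} | A \in glued_classes} :=
  fun A B => [exists s, exists u, exists v,
    [&& (s, u) \in val A, (s, v) \in val B & adj u v]].

Fact glued_sym : symmetric glued_adj.
Proof.
have imp A B : glued_adj A B -> glued_adj B A.
  case/existsP=> s /existsP[u /existsP[v /and3P[su sv uv]]].
  apply/existsP; exists s; apply/existsP; exists v; apply/existsP; exists u.
  by rewrite su sv adj_sym.
by move=> A B; apply/idP/idP; exact: imp.
Qed.

Fact connect_identified p q : connect identified p q -> p.2 = q.2.
Proof.
case/connectP=> c; elim: c p => [|r c IHc] p /=; first by move=> _ ->.
by case/andP=> /and3P[_ /eqP-> _] pc /(IHc _ pc).
Qed.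

Fact glued_irrefl : irreflexive glued_adj.
Proof.
case=> A /= AJ; apply/negbTE/negP=> /existsP[s /existsP[u /existsP[v /and3P[/=]]]].
case/imsetP: AJ => p _ ->; rewrite !inE => /andP[_ pu] /andP[_ pv].
have /= <- := connect_identified pu; have /= <- := connect_identified pv.
by rewrite adj_irrefl.
Qed.

Definition glued : sgraph := SGraph glued_sym glued_irrefl.
End GluedGraph.

Section GoodTemplate.
Variables (R : realType) (F : sgraph).

Definition aut_equiv : rel {set F} := fun S1 S2 =>
  [exists f : {perm F}, automorphism f && (f @: S1 == S2)].

Definition aut_classes : {set {set {set F}}} :=
  equivalence_partition aut_equiv [set S : {set F} | S != finset.set0].

Definition aut_class := {C : {set {set F}} | C \in aut_classes}.

Definition class_space := {ffun aut_class -> R}.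

Definition evec (S : {set F}) : class_space :=
  if S == finset.set0 then 0 else [ffun C : aut_class => (S \in val C)%:R].

Definition zvec (P : template F) : class_space :=
  \sum_(s : tree P) evec (psiV P s) - \sum_(e in edges (tree P)) evec (psiE P e).

Definition xvec (R1 R2 R3 : {set F}) : class_space :=
  evec (R1 :|: R2 :|: R3) - evec (R2 :|: R3) - evec (R1 :|: R2) + evec R2.

Definition disjoint3 (r : {set F} * {set F} * {set F}) : bool :=
  [&& [disjoint r.1.1 & r.1.2], [disjoint r.1.1 & r.2] &
      [disjoint r.1.2 & r.2]].

Definition good (P : template F) : Prop :=
  (0 < nedges (glued P))%N /\
  exists2 c : {set F} * {set F} * {set F} -> R,
    (forall r, 0 <= c r) &
    ((nedges (glued P))%:R / (nedges F)%:R) *: evec [set: F] - zvec P =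
      \sum_(r | disjoint3 r) c r *: xvec r.1.1 r.1.2 r.2.
End GoodTemplate.

Local Open Scope classical_set_scope.

Section UnitCubeMeasure.
Variable R : realType.
Local Notation mR := (measurableTypeR R).

Definition tuple_cons (n : nat) (p : mR * n.-tuple mR) : n.+1.-tuple mR :=
  [tuple of p.1 :: p.2].

Fact measurable_tuple_cons n : measurable_fun setT (@tuple_cons n).
Proof. exact: measurable_cons. Qed.

HB.instance Definition _ n :=
  isMeasurableFun.Build _ _ _ _ (@tuple_cons n) (@measurable_tuple_cons n).

(* The n-fold product of the Lebesgue measure of [0, 1]. *)
Fixpoint cube_prob (n : nat) : probability (n.-tuple mR) R :=
  if n is k.+1 then
    distribution (uniform_prob (@ltr01 R) \x cube_prob k)%E (@tuple_cons k)
  else dirac ([tuple] : 0.-tuple mR).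
End UnitCubeMeasure.

Section Graphons.
Variable R : realType.
Local Notation mR := (measurableTypeR R).

Definition unit_square : set (mR * mR) := `[0, 1] `*` `[0, 1].

(* Only the restriction of W to the unit square is relevant. *)
Definition graphon (W : mR * mR -> R) : Prop :=
  [/\ measurable_fun unit_square W,
      (forall x y, unit_square (x, y) -> W (x, y) = W (y, x)) &
      (forall z, unit_square z -> 0 <= W z <= 1)].

(* The vertex u has the coordinate of index [enum_rank u].  Each edge uv is
   counted once, oriented by the enumeration of the vertices; for symmetric W
   the orientation is irrelevant. *)
Definition hom_density (H : sgraph) (W : mR * mR -> R) : R :=
  \int[cube_prob R #|H|]_(x in [set x | forall i, 0 <= tnth x i <= 1])
    \prod_(p : H * H | adj p.1 p.2 && (enum_rank p.1 < enum_rank p.2)%N)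
      W (tnth x (enum_rank p.1), tnth x (enum_rank p.2)).

Definition common (p1 p2 : R) (H1 H2 : sgraph) : Prop :=
  [/\ (0 < nedges H1)%N, (0 < nedges H2)%N &
    forall W1 W2 : mR * mR -> R, graphon W1 -> graphon W2 ->
      (forall z, unit_square z -> W1 z + W2 z = 1) ->
      p1 / (nedges H1)%:R + p2 / (nedges H2)%:R <=
      hom_density H1 W1 / ((nedges H1)%:R * p1 ^+ (nedges H1).-1) +
      hom_density H2 W2 / ((nedges H2)%:R * p2 ^+ (nedges H2).-1)].
End Graphons.

(* Main.v *)
Require Import Defs.
From HB Require Import structures.
From mathcomp Require Import all_boot all_order all_algebra all_fingroup.
From mathcomp Require Import all_classical all_reals all_analysis.
From mathcomp Require Import measurable_realfun.
From mathcomp Require Import polyrcf ring lra zify.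

Set Implicit Arguments.
Unset Strict Implicit.
Unset Printing Implicit Defensive.

Import Order.TTheory GRing.Theory Num.Theory.
Import numFieldNormedType.Exports.
Local Open Scope ring_scope.

(**
The inequality to prove is linear in the homomorphism densities.  It therefore
suffices to prove it for finite weighted graphs: evaluating W1 and W2 at n
uniform random points gives such graphs, and the expected densities differ from
those of W1 and W2 by O(1/n), the proportion of non-injective maps.

For a finite weight w, let c, d, t be the densities of C_m, K_2 and H.
- The entropy method gives t(J) >= c^(e(J)/m): glue copies of a random map
  C_m -> V, chosen with probability proportional to its weight, along the tree,
  independently given the values on the sets psi(st).  The entropy of the result
  is the value on z_(T,psi) of a functional that is nonpositive on the vectors
  x_(R1,R2,R3) by submodularity.  As t(J) = t d^l, this reads
  (t d^l)^m >= c^(e(H)+l).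
- By the weighted AM-GM inequality, (e + l) c / p^m is at most
  m t / p^e + l (d / p)^m + (e - m), where e = e(H) >= m.
- For w1 + w2 = 1 and m odd, c1 + c2 >= d1^m + d2^m: with A the matrix of w1
  and u the normalised constant vector, the derivative in s of
  - tr (A - s u u^T)^m is m u^T (A - s u u^T)^(m-1) u >= m (d1 - s)^(m-1).
The balance condition makes the coefficients of c1 and c2 equal, and Bernoulli's
inequality concludes.
*)

(** * Averages over finite maps and densities *)


(** Finite weights keep the entropy elementary: every law has finite support, and no differential
    entropy on [0, 1] occurs.

    Two quantities travel beside the entropy. Let [l] be the expected [ln w] on an edge of the
    random copy of C_m. Since C_m is edge-transitive, [l] is the same for every edge, so C_m and J
    carry the log-weights m l and e(J) l; their ratio is the coefficient of e_(V(F)) in the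
    definition of a good template. Normalising by powers of |V| replaces the entropy on S by the
    entropy minus |S| ln |V|; the correction vanishes on x_(R1,R2,R3) because the R_i are disjoint.

    Sampled weights keep their diagonal: w1 + w2 = 1 must hold there too, for the matrix of w2 to be
    u u^T minus that of w1. The loops so created are seen by non-injective maps only.

    AM-GM, the cycle inequality and Bernoulli are all sharp at the constant weights p1, p2. What
    they leave are the linear terms d1 - p1 and d2 - p2, which cancel as d1 + d2 = p1 + p2. *)

Section Average.
Variables (R : realType) (V : finType).
Hypothesis V_gt0 : (0 < #|V|)%N.

Definition avg (A : finType) (f : {ffun A -> V} -> R) : R :=
  (\sum_phi f phi) / (#|V| ^ #|A|)%:R.

Lemma avg_card_neq0 (A : finType) : (#|V| ^ #|A|)%:R != 0 :> R.
Proof. by rewrite pnatr_eq0 -lt0n expn_gt0 V_gt0. Qed.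

Lemma eq_avg (A : finType) (f g : {ffun A -> V} -> R) :
  f =1 g -> avg f = avg g.
Proof. by move=> fg; congr (_ / _); apply: eq_bigr. Qed.

Lemma avg_cst (A : finType) (c : R) : avg (fun _ : {ffun A -> V} => c) = c.
Proof.
by rewrite /avg sumr_const card_ffun -[c *+ _]mulr_natr mulfK// avg_card_neq0.
Qed.

Lemma avg_ge0 (A : finType) (f : {ffun A -> V} -> R) :
  (forall phi, 0 <= f phi) -> 0 <= avg f.
Proof. by move=> f0; rewrite divr_ge0 ?ler0n// sumr_ge0. Qed.

(* Exchanging the values of phi on the range of h with those of psi is an
   involution of the set of pairs (phi, psi). *)
Lemma avg_inj (A B : finType) (h : A -> B) (f : {ffun A -> V} -> R) :
  injective h ->
  avg (fun phi : {ffun B -> V} => f [ffun a => phi (h a)]) = avg f.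
Proof.
move=> h_inj; pose res (phi : {ffun B -> V}) : {ffun A -> V} :=
  [ffun a => phi (h a)].
pose ins (phi : {ffun B -> V}) (psi : {ffun A -> V}) : {ffun B -> V} :=
  [ffun b => if [pick a | h a == b] is Some a then psi a else phi b].
have insh phi psi a : ins phi psi (h a) = psi a.
  rewrite ffunE; case: pickP => [a' /eqP/h_inj->//|/(_ a)]; by rewrite eqxx.
have res_ins phi psi : res (ins phi psi) = psi.
  by apply/ffunP => a; rewrite ffunE insh.
have ins_ins phi psi : ins (ins phi psi) (res phi) = phi.
  apply/ffunP => b; rewrite ffunE; case: pickP => [a /eqP<-|nb].
    by rewrite ffunE.
  by rewrite ffunE; case: pickP => // a; rewrite nb.
pose sw (p : {ffun B -> V} * {ffun A -> V}) := (ins p.1 p.2, res p.1).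
have swK : involutive sw.
  by case=> phi psi; rewrite /sw/= ins_ins res_ins.
have : \sum_(p : {ffun B -> V} * {ffun A -> V}) f (res p.1) =
       \sum_(p : {ffun B -> V} * {ffun A -> V}) f p.2.
  rewrite (reindex_inj (can_inj swK)); apply: eq_bigr => -[phi psi] _.
  by rewrite /= res_ins.
rewrite -(pair_bigA _ (fun p (q : {ffun A -> V}) => f (res p)))/=.
rewrite -(pair_bigA _ (fun (p : {ffun B -> V}) q => f q))/=.
rewrite sumr_const card_ffun.
under eq_bigr do rewrite sumr_const card_ffun.
rewrite sumrMnl /avg => sumE.
apply/eqP; rewrite eqr_div ?avg_card_neq0//.
by rewrite !mulr_natr sumE.
Qed.

(** Exchanging the values of [phi] and [psi] outside [S] is an involution of the pairs that turns
    [f phi * g phi] into [f phi * g psi]. *)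
Lemma avg_indep (B : finType) (S : {set B}) (f g : {ffun B -> V} -> R) :
  (forall phi psi : {ffun B -> V}, {in S, phi =1 psi} -> f phi = f psi) ->
  (forall phi psi : {ffun B -> V}, {in ~: S, phi =1 psi} -> g phi = g psi) ->
  avg (fun phi => f phi * g phi) = avg f * avg g.
Proof.
move=> fS gS.
pose mix (phi psi : {ffun B -> V}) : {ffun B -> V} :=
  [ffun b => if b \in S then phi b else psi b].
pose sw (p : {ffun B -> V} * {ffun B -> V}) := (mix p.1 p.2, mix p.2 p.1).
have swK : involutive sw.
  case=> phi psi; rewrite /sw/=; congr (_, _); apply/ffunP => b;
  by rewrite !ffunE; case: (b \in S).
have : \sum_(p : {ffun B -> V} * {ffun B -> V}) f p.1 * g p.1 =
       \sum_(p : {ffun B -> V} * {ffun B -> V}) f p.1 * g p.2.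
  rewrite (reindex_inj (can_inj swK)); apply: eq_bigr => -[phi psi] _ /=.
  congr (_ * _); [apply: fS|apply: gS] => b; rewrite ?inE ffunE.
    by move->.
  by move/negbTE->.
rewrite -(pair_bigA _ (fun p (q : {ffun B -> V}) => f p * g p))/=.
rewrite -(pair_bigA _ (fun p q => f p * g q))/=.
under eq_bigr do rewrite sumr_const card_ffun.
rewrite sumrMnl.
under [RHS]eq_bigr do rewrite -mulr_sumr.
rewrite -mulr_suml => sumE.
rewrite /avg mulrACA -sumE -invfM -[X in _ = X / _]mulr_natr.
by rewrite -mulf_div divff ?avg_card_neq0// mulr1.
Qed.

End Average.

Section EdgeProduct.
Variables (R : realType) (U : Type) (w : U -> U -> R).
Hypothesis w_sym : forall x y, w x y = w y x.
Hypothesis w_ge0 : forall x y, 0 <= w x y.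

Definition edge_prod_on (G : sgraph) (A : {set G}) (phi : G -> U) : R :=
  \prod_(p : G * G | [&& adj p.1 p.2, (enum_rank p.1 < enum_rank p.2)%N,
                         p.1 \in A & p.2 \in A])
    w (phi p.1) (phi p.2).

Definition edge_prod (G : sgraph) (phi : G -> U) : R :=
  \prod_(p : G * G | adj p.1 p.2 && (enum_rank p.1 < enum_rank p.2)%N)
    w (phi p.1) (phi p.2).

Lemma edge_prodE (G : sgraph) (phi : G -> U) :
  edge_prod phi = edge_prod_on [set: G] phi.
Proof. by apply: eq_bigl => p; rewrite !inE !andbT. Qed.

Lemma edge_prod_on_ge0 (G : sgraph) (A : {set G}) (phi : G -> U) :
  0 <= edge_prod_on A phi.
Proof. by apply: prodr_ge0. Qed.

(** Squaring removes the dependence on the enumeration that orients the edges. Since the products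
    are nonnegative, graphs with unrelated enumerations can be compared through their squares. *)
Lemma edge_prod_on_sqr (G : sgraph) (A : {set G}) (phi : G -> U) :
  edge_prod_on A phi ^+ 2 =
  \prod_(p : G * G | [&& adj p.1 p.2, p.1 \in A & p.2 \in A])
     w (phi p.1) (phi p.2).
Proof.
pose sw (p : G * G) := (p.2, p.1).
have swK : involutive sw by case.
rewrite (bigID (fun p : G * G => enum_rank p.1 < enum_rank p.2)%N)/= expr2.
congr (_ * _).
  by apply: eq_bigl => p; rewrite -!andbA; do ?bool_congr.
rewrite /edge_prod_on (reindex_inj (can_inj swK)); apply: eq_big => [[x y]|[x y] _] /=.
  rewrite adj_sym -leqNgt -!andbA; case xy : (adj x y) => //=.
  rewrite [RHS]andbA [RHS]andbC andbCA andbC -andbA.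
  rewrite (leq_eqVlt (enum_rank y)); case: (eqVneq (enum_rank y : nat)) => //=.
  by move=> /val_inj/enum_rank_inj yx; move: xy; rewrite yx adj_irrefl.
by rewrite w_sym.
Qed.

Lemma eq_edge_prod_on (G H : sgraph) (A : {set G}) (B : {set H})
    (phi : G -> U) (psi : H -> U) :
  edge_prod_on A phi ^+ 2 = edge_prod_on B psi ^+ 2 ->
  edge_prod_on A phi = edge_prod_on B psi.
Proof. by apply: pexpIrn => //; rewrite nnegrE edge_prod_on_ge0. Qed.

Lemma edge_prod_embed (H J : sgraph) (h : H -> J) (phi : J -> U) :
  injective h -> (forall x y, adj (h x) (h y) = adj x y) ->
  edge_prod (phi \o h) = edge_prod_on (h @: [set: H]) phi.
Proof.
move=> h_inj hadj; rewrite edge_prodE; apply: eq_edge_prod_on.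
rewrite !edge_prod_on_sqr.
pose hh (p : H * H) := (h p.1, h p.2).
have hh_inj : injective hh by move=> [a b] [c d] [/h_inj-> /h_inj->].
rewrite [RHS](eq_bigl (fun q => q \in hh @: [set p : H * H | adj p.1 p.2])).
  rewrite big_imset /=; last by move=> ? ? _ _ /hh_inj.
  by apply: eq_bigl => p; rewrite !inE !andbT.
move=> [x y] /=; apply/and3P/imsetP => [[xy /imsetP[a _ xa] /imsetP[b _ yb]]|].
  by exists (a, b); rewrite ?inE /hh ?xa ?yb//= -hadj -xa -yb.
by case=> -[a b]; rewrite inE /= => ab [-> ->]; rewrite hadj !imset_f ?inE.
Qed.

Lemma edge_prod_onU (J : sgraph) (A B : {set J}) (phi : J -> U) :
  [disjoint A & B] -> (forall x y, x \in A -> y \in B -> ~~ adj x y) ->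
  edge_prod_on (A :|: B) phi = edge_prod_on A phi * edge_prod_on B phi.
Proof.
move=> AB nadj.
rewrite /edge_prod_on (bigID (fun p => p.1 \in A))/=; congr (_ * _);
  apply: eq_bigl => -[x y] /=; rewrite !inE; case xy: (adj x y) => //=;
  case: ltnP => //= _; have yx := xy; rewrite adj_sym in yx;
  have := nadj x y; have := nadj y x; rewrite xy yx;
  have := disjointFr AB (x := x); have := disjointFr AB (x := y);
  case: (x \in A) (x \in B) (y \in A) (y \in B) => [] [] [] [] //= H1 H2 H3 H4;
  by [have := H1 isT|have := H2 isT|have := H3 isT isT|have := H4 isT isT].
Qed.

End EdgeProduct.

Lemma card_oriented_edges (G : sgraph) :
  #|[pred p : G * G | adj p.1 p.2 && (enum_rank p.1 < enum_rank p.2)%N]| =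
  nedges G.
Proof.
pose D := [set p : G * G | adj p.1 p.2 && (enum_rank p.1 < enum_rank p.2)%N].
transitivity #|D|; first by apply: eq_card => p; rewrite [RHS]inE.
have D_inj : {in D &, injective (fun p : G * G => [set p.1; p.2])}.
  move=> [x y] [x' y']; rewrite !inE /= => /andP[_ xy] /andP[_ xy'] E.
  have : x \in [set x'; y'] by rewrite -E !inE eqxx.
  have : y \in [set x'; y'] by rewrite -E !inE eqxx orbT.
  rewrite !inE => /orP[]/eqP ey /orP[]/eqP ex; subst => //;
    by rewrite ?ltnn// in xy; have := ltn_trans xy xy'; rewrite ltnn.
rewrite -(card_in_imset D_inj); apply: eq_card => e.
apply/imsetP/imsetP => -[[x y]]; rewrite !inE /=.
  by move=> /andP[xy _] ->; exists (x, y).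
move=> xy ->.
have : enum_rank x != enum_rank y.
  by apply: contraTneq xy => /enum_rank_inj->; rewrite adj_irrefl.
rewrite -(inj_eq val_inj) neq_ltn => /orP[lt|lt].
  by exists (x, y); rewrite // inE xy.
by exists (y, x); rewrite ?inE 1?adj_sym ?xy//= finset.setUC.
Qed.

Lemma edge_prod_cst (R : realType) (U : Type) (G : sgraph) (phi : G -> U) (c : R) :
  edge_prod (fun _ _ => c) phi = c ^+ nedges G.
Proof. by rewrite /edge_prod prodr_const card_oriented_edges. Qed.

Section Density.
Variables (R : realType) (V : finType) (w : V -> V -> R).
Hypothesis V_gt0 : (0 < #|V|)%N.
Hypothesis w_sym : forall x y, w x y = w y x.
Hypothesis w_ge0 : forall x y, 0 <= w x y.

Definition dens (G : sgraph) : R :=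
  avg (fun phi : {ffun G -> V} => edge_prod w phi).

Definition edge_dens : R := (\sum_x \sum_y w x y) / (#|V| ^ 2)%:R.

(** The average runs over maps of all of [G], whatever [A] is, so that disjoint parts of one graph
    become independent factors on a common space. *)
Definition dens_on (G : sgraph) (A : {set G}) : R :=
  avg (fun phi : {ffun G -> V} => edge_prod_on w A phi).

Lemma dens_ge0 (G : sgraph) : 0 <= dens G.
Proof. by apply: avg_ge0 => phi; rewrite edge_prodE edge_prod_on_ge0. Qed.

Lemma edge_dens_ge0 : 0 <= edge_dens.
Proof. by rewrite divr_ge0// sumr_ge0// => x _; rewrite sumr_ge0. Qed.

Lemma edge_densE (J : sgraph) (x y : J) : x != y ->
  avg (fun phi : {ffun J -> V} => w (phi x) (phi y)) = edge_dens.
Proof.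
move=> xy; pose h (b : bool) := if b then x else y.
have h_inj : injective h.
  by case=> [] [] //= E; move: xy; rewrite E eqxx.
have := avg_inj V_gt0 (fun psi : {ffun bool -> V} => w (psi true) (psi false)) h_inj.
under [X in avg X]boolp.funext => phi do rewrite !ffunE.
move=> ->; rewrite /avg /edge_dens card_bool; congr (_ / _).
pose pr (q : V * V) : {ffun bool -> V} := [ffun b => if b then q.1 else q.2].
rewrite (reindex pr); last first.
  exists (fun psi : {ffun bool -> V} => (psi true, psi false)) => [[a b]|psi] _.
    by rewrite !ffunE.
  by apply/ffunP => -[]; rewrite !ffunE.
by rewrite pair_bigA; apply: eq_bigr => -[a b] _; rewrite !ffunE.
Qed.

Lemma edge_prod_on_local (G : sgraph) (A : {set G}) (phi psi : {ffun G -> V}) :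
  {in A, phi =1 psi} -> edge_prod_on w A phi = edge_prod_on w A psi.
Proof. by move=> E; apply: eq_bigr => p /and4P[_ _ /E-> /E->]. Qed.

Lemma dens_onU (J : sgraph) (A B : {set J}) :
  [disjoint A & B] -> (forall x y, x \in A -> y \in B -> ~~ adj x y) ->
  dens_on (A :|: B) = dens_on A * dens_on B.
Proof.
move=> AB nadj; rewrite -(avg_indep V_gt0 (S := A)).
- by apply: eq_avg => phi; rewrite edge_prod_onU.
- exact: edge_prod_on_local.
- move=> phi psi E; apply: edge_prod_on_local => x xB; apply: E.
  by rewrite inE (disjointFl AB).
Qed.

Lemma dens_embed (H J : sgraph) (h : H -> J) :
  injective h -> (forall x y, adj (h x) (h y) = adj x y) ->
  dens H = dens_on (h @: [set: H]).
Proof.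
move=> h_inj hadj; rewrite /dens -(avg_inj V_gt0 _ h_inj).
apply: eq_avg => phi; rewrite -(edge_prod_embed w_sym w_ge0 _ h_inj hadj).
by apply: eq_bigr => p _; rewrite !ffunE.
Qed.

Lemma dens_on0 (J : sgraph) : dens_on (finset.set0 : {set J}) = 1.
Proof.
rewrite -[RHS](@avg_cst R V V_gt0 J); apply: eq_avg => phi.
by rewrite /edge_prod_on big_pred0// => p; rewrite !inE !andbF.
Qed.

Lemma dens_on1 (J : sgraph) (x : J) : dens_on [set x] = 1.
Proof.
rewrite -[RHS](@avg_cst R V V_gt0 J); apply: eq_avg => phi.
rewrite /edge_prod_on big_pred0// => -[y z] /=; rewrite !inE.
by apply/and4P => -[yz _ /eqP yx /eqP zx]; move: yz; rewrite yx zx adj_irrefl.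
Qed.

Lemma dens_on2 (J : sgraph) (x y : J) : adj x y ->
  dens_on [set x; y] = edge_dens.
Proof.
move=> xy; have xNy : x != y by apply: contraTneq xy => ->; rewrite adj_irrefl.
rewrite -(edge_densE xNy); apply: eq_avg => phi.
apply: (@pexpIrn _ 2) => //; rewrite ?nnegrE ?edge_prod_on_ge0//.
rewrite edge_prod_on_sqr//.
rewrite (bigD1 (x, y)) ?xy ?inE ?eqxx ?orbT//= (bigD1 (y, x))/=; last first.
  by rewrite adj_sym xy !inE !eqxx ?orbT/= xpair_eqE negb_and eq_sym xNy.
rewrite big_pred0 ?mulr1 1?[w (phi y) _]w_sym// => -[a b] /=.
rewrite !inE !xpair_eqE; have [->|] := eqVneq a x; have [->|] := eqVneq b y;
  rewrite ?eqxx ?andbF//=.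
- move=> bNy; have [->|] := eqVneq b x; rewrite ?adj_irrefl ?andbF ?andFb//=.
- move=> aNx; have [->|] := eqVneq a y; rewrite ?adj_irrefl ?andbF ?andFb//=.
- by move=> bNy aNx; have [->|] := eqVneq a y; have [->|] := eqVneq b x;
    rewrite ?andbF.
Qed.

End Density.

Lemma edge_densD (R : realType) (V : finType) (w1 w2 : V -> V -> R) :
  (0 < #|V|)%N -> (forall x y, w1 x y + w2 x y = 1) ->
  edge_dens w1 + edge_dens w2 = 1.
Proof.
move=> V0 w12; have V_neq0 : #|V|%:R != 0 :> R by rewrite pnatr_eq0 -lt0n.
rewrite /edge_dens -mulrDl -big_split /=.
rewrite (eq_bigr (fun _ => #|V|%:R)) => [|x _]; last first.
  rewrite -big_split /= (eq_bigr (fun _ => 1)) => [|y _]; last exact: w12.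
  by rewrite sumr_const.
by rewrite sumr_const -[X in X / _]mulr_natr natrX expr2 divff// mulf_neq0.
Qed.

(** * Deletion of components *)

Section Components.
Variable J : sgraph.

Lemma components_partition : finset.partition (components J) [set: J].
Proof.
apply: equivalence_partitionP => x y z _ _ _; split=> // xy.
exact: (same_connect (sym_connect_sym (@adj_sym J))).
Qed.

Lemma component_closed (C : {set J}) x y :
  C \in components J -> x \in C -> adj x y -> y \in C.
Proof.
case/imsetP => z _ ->; rewrite !inE /= => zx xy.
by apply: connect_trans zx (connect1 xy).
Qed.

Lemma components_disjoint (C D : {set J}) :
  C \in components J -> D \in components J -> C != D -> [disjoint C & D].
Proof.
move=> CJ DJ.
by apply: (finset.trivIsetP (finset.partition_trivIset components_partition)).
Qed.

Lemma component2P (C : {set J}) : C \in components J -> #|C| = 2 ->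
  exists x y, C = [set x; y] /\ adj x y.
Proof.
move=> CJ /eqP/cards2P[x [y [xNy CE]]]; exists x, y; split=> //.
case/imsetP: (CJ) => z _ CE'.
have : connect (@adj J) x y.
  have xC : x \in C by rewrite CE !inE eqxx.
  have yC : y \in C by rewrite CE !inE eqxx orbT.
  move: xC yC; rewrite CE' !inE /= => zx zy.
  by rewrite -(same_connect (sym_connect_sym (@adj_sym J)) zx).
case/connectP => -[/=|a p /= /andP[xa _] _]; first by move=> _ E; rewrite E eqxx in xNy.
have : a \in C by apply: component_closed xa => //; rewrite CE !inE eqxx.
rewrite CE !inE => /orP[]/eqP E; move: xa; rewrite E ?adj_irrefl//.
Qed.

Lemma cover_closed (D : {set {set J}}) x y : D \subset components J ->
  x \in finset.cover D -> adj x y -> y \in finset.cover D.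
Proof.
move=> DJ /bigcupP[C CD xC] xy; apply/bigcupP; exists C => //.
by apply: component_closed xy => //; apply: (fintype.subsetP DJ).
Qed.

End Components.

Section Deletion.
Variables (R : realType) (V : finType) (w : V -> V -> R).
Hypothesis V_gt0 : (0 < #|V|)%N.
Hypothesis w_sym : forall x y, w x y = w y x.
Hypothesis w_ge0 : forall x y, 0 <= w x y.

Lemma dens_on_cover (J : sgraph) (D : {set {set J}}) :
  D \subset components J ->
  dens_on w (finset.cover D) = \prod_(C in D) dens_on w C.
Proof.
have [k] := ubnP #|D|; elim: k => // k IH in D * => Dk DJ.
have [->|[C CD]] := set_0Vmem D.
  by rewrite /finset.cover !big_set0 dens_on0.
rewrite (big_setD1 C CD)/= -IH; last 2 first.
- by move: Dk; rewrite (cardsD1 C) CD.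
- by apply: fintype.subset_trans DJ; exact: subsetDl.
rewrite -dens_onU//.
- by rewrite /finset.cover (big_setD1 C CD).
- apply/bigcup_disjointP => E; rewrite !inE => /andP[EC ED].
  rewrite disjoint_sym.
  by apply: components_disjoint => //; exact: (fintype.subsetP DJ).
- move=> x y xC /bigcupP[E]; rewrite !inE => /andP[EC ED] yE.
  have EJ := fintype.subsetP DJ _ ED; have CJ := fintype.subsetP DJ _ CD.
  apply/negP => xy; have yC := component_closed CJ xC xy.
  by have := disjointFr (components_disjoint EJ CJ EC) yE; rewrite yC.
Qed.

(** Densities multiply over components: a one-vertex component contributes 1, and a two-vertex
    component, being an edge, the edge density. *)
Lemma dens_deletion (J H : sgraph) (l : nat) :
  obtained_by_deletion J l H -> dens w J = dens w H * edge_dens w ^+ l.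
Proof.
case=> D2 [D1 [D2J D2l D1J [f f_bij fadj]]].
have D2s : D2 \subset components J.
  by apply: fintype.subset_trans D2J _; apply/fintype.subsetP => C; rewrite inE => /andP[].
have D1s : D1 \subset components J.
  by apply: fintype.subset_trans D1J _; apply/fintype.subsetP => C; rewrite inE => /andP[].
set D := D2 :|: D1 in f f_bij fadj *.
have Ds : D \subset components J by rewrite finset.subUset D2s D1s.
have -> : dens w J = dens_on w (~: finset.cover D :|: finset.cover D).
  rewrite finset.setUC finset.setUCr.
  by apply: eq_avg => phi; rewrite edge_prodE.
rewrite dens_onU//; last 2 first.
- by rewrite -finset.setI_eq0 finset.setIC finset.setICr.
- move=> x y; rewrite inE => xD yD; apply: contra xD; rewrite adj_sym.
  exact: cover_closed.
congr (_ * _).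
  rewrite (dens_embed V_gt0 w_sym w_ge0 (h := fun x => val (f x))).
  - congr dens_on; apply/setP => x; apply/idP/imsetP => [xD|[y _ ->]].
      have [g fK gK] := f_bij.
      by exists (g (exist _ x xD)); rewrite ?inE ?gK.
    exact: (valP (f y)).
  - by move=> x y /val_inj/(bij_inj f_bij).
  - by move=> x y; rewrite -fadj.
rewrite dens_on_cover// (big_setID D2)/= [X in _ * X]big1 ?mulr1; last first.
  move=> C; rewrite !inE => /andP[CD2]; rewrite (negbTE CD2)/= => CD1.
  have := fintype.subsetP D1J _ CD1; rewrite inE => /andP[_ /cards1P[x ->]].
  exact: dens_on1.
rewrite -D2l -prodr_const; apply: eq_big => C.
  by rewrite !inE; case: (C \in D2); rewrite ?andbF.
rewrite !inE => /andP[_ CD2].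
have := fintype.subsetP D2J _ CD2; rewrite inE => /andP[CJ /eqP C2].
have [x [y [-> xy]]] := component2P CJ C2.
exact: dens_on2.
Qed.

End Deletion.

Lemma dens_cst (R : realType) (V : finType) (G : sgraph) (c : R) :
  (0 < #|V|)%N -> dens (fun _ _ : V => c) G = c ^+ nedges G.
Proof.
by move=> V0; rewrite -[RHS](avg_cst V0 G); apply: eq_avg => phi; rewrite edge_prod_cst.
Qed.

(* The edges are counted by comparing densities for a constant weight. *)
Lemma nedges_deletion (R : realType) (J H : sgraph) (l : nat) :
  obtained_by_deletion J l H -> nedges J = (nedges H + l)%N.
Proof.
move=> del; pose w (_ _ : unit) : R := 2.
have V0 : (0 < #|{: unit}|)%N by rewrite card_unit.
have := dens_deletion (w := w) V0 (fun _ _ => erefl) (fun _ _ => ler0n _ 2) del.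
rewrite !dens_cst// /edge_dens card_unit exp1n divr1.
rewrite (eq_bigr (fun _ => 2)); last first.
  by move=> x _; rewrite sumr_const card_unit.
rewrite sumr_const card_unit mulr1n -exprD.
by apply: ieexprIn; rewrite ?ltr0n// pnatr_eq1.
Qed.

(** * A trace inequality *)

Section QuadraticForm.
Variables (R : realType) (n : nat) (M : 'M[R]_n.+1) (u : 'cV[R]_n.+1).
Hypothesis M_sym : M^T = M.

Let form (N : 'M[R]_n.+1) : R := (u^T *m N *m u) ord0 ord0.

Let dotmul (x y : 'cV[R]_n.+1) : R := (x^T *m y) ord0 ord0.

Let dotmul_ge0 x : 0 <= dotmul x x.
Proof. by rewrite /dotmul mxE sumr_ge0// => i _; rewrite mxE -expr2 sqr_ge0. Qed.

Let dotmul_eq0 x : dotmul x x = 0 -> x = 0.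
Proof.
rewrite /dotmul mxE => /eqP; rewrite psumr_eq0; last first.
  by move=> i _; rewrite mxE -expr2 sqr_ge0.
move=> /allP x0; apply/colP => i; rewrite !mxE.
have := x0 i (mem_index_enum _); rewrite mxE /= mulf_eq0 orbb => /eqP //.
Qed.

Let dotmulDl a x y z : dotmul (a *: x + y) z = a * dotmul x z + dotmul y z.
Proof. by rewrite /dotmul linearP/= mulmxDl -scalemxAl !mxE. Qed.

Let dotmulC x y : dotmul x y = dotmul y x.
Proof. by rewrite /dotmul !mxE; apply: eq_bigr => i _; rewrite !mxE mulrC. Qed.

Let cauchy_schwarz x y : dotmul x y ^+ 2 <= dotmul x x * dotmul y y.
Proof.
have [y0|] := eqVneq (dotmul y y) 0.
  have -> : dotmul x y = 0 by rewrite (dotmul_eq0 y0) /dotmul mulmx0 mxE.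
  by rewrite y0 mulr0 expr0n.
move=> yN0; have y_gt0 : 0 < dotmul y y by rewrite lt_neqAle eq_sym yN0 dotmul_ge0.
pose a := - (dotmul x y / dotmul y y).
have := dotmul_ge0 (a *: y + x).
rewrite dotmulDl 2![dotmul _ (_ + _)]dotmulC !dotmulDl [dotmul y x]dotmulC.
have -> : a * (a * dotmul y y + dotmul x y) + (a * dotmul x y + dotmul x x) =
  (dotmul x x * dotmul y y - dotmul x y ^+ 2) / dotmul y y.
  by rewrite /a; field.
by rewrite pmulr_lge0 ?invr_gt0// subr_ge0.
Qed.

Let trX k : (M ^+ k)^T = M ^+ k.
Proof.
elim: k => [|k IH]; first by rewrite expr0 trmx1.
by rewrite exprS -mulmxE trmx_mul IH M_sym mulmxE -exprSr exprS.
Qed.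

Let formD i j : form (M ^+ (i + j)) = dotmul (M ^+ i *m u) (M ^+ j *m u).
Proof. by rewrite /form /dotmul trmx_mul trX exprD mulmxA mulmxA. Qed.

(* The even moments b_j := u^T M^(2j) u are log-convex, so b_(j+1) >= b_1 b_j. *)
Lemma form_expr_even k : dotmul u u = 1 ->
  form M ^+ (2 * k) <= form (M ^+ (2 * k)).
Proof.
move=> u1; pose b j := form (M ^+ (j + j)).
have b0 : b 0 = 1 by rewrite /b /form expr0 mulmx1.
have b_ge0 j : 0 <= b j by rewrite /b formD dotmul_ge0.
have bS j : b 1 * b j <= b j.+1.
  elim: j => [|j IH]; first by rewrite b0 mulr1.
  have [bj0|bjN0] := eqVneq (b j) 0.
    suff -> : b j.+1 = 0 by rewrite mulr0.
    move: bj0; rewrite /b !formD => /dotmul_eq0 Mju.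
    by rewrite exprS -mulmxE -mulmxA Mju mulmx0 /dotmul mulmx0 mxE.
  have bj_gt0 : 0 < b j by rewrite lt_neqAle eq_sym bjN0 b_ge0.
  rewrite -(ler_pM2l bj_gt0) mulrCA mulrA.
  apply: (@le_trans _ _ (b j.+1 * b j.+1)); first by rewrite ler_wpM2r.
  have -> : b j.+1 = dotmul (M ^+ j *m u) (M ^+ j.+2 *m u).
    by rewrite -formD /b; congr (form (M ^+ _)); rewrite !addnS !addSn.
  by rewrite -expr2 (le_trans (cauchy_schwarz _ _))// /b !formD.
have b1 : form M ^+ 2 <= b 1.
  have -> : form M = dotmul (M ^+ 0 *m u) (M ^+ 1 *m u).
    by rewrite -formD expr1.
  apply: le_trans (cauchy_schwarz _ _) _.
  by rewrite expr0 mul1mx u1 mul1r /b formD.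
suff H j : (form M ^+ 2) ^+ j <= b j by rewrite exprM mul2n -addnn.
elim: j => [|j IH]; first by rewrite expr0 b0.
rewrite exprS; apply: le_trans (bS j).
by apply: ler_pM; rewrite ?sqr_ge0 ?(exprn_ge0 _ (sqr_ge0 _)).
Qed.

End QuadraticForm.

Section DerivPolyMatrix.
Variables (R : comNzRingType) (n : nat).
Implicit Types M N : 'M[{poly R}]_n.+1.

Let dmx M := map_mx (@deriv R) M.

Let dmxM M N : dmx (M * N) = dmx M * N + M * dmx N.
Proof.
apply/matrixP => i j; rewrite !mxE raddf_sum -big_split; apply: eq_bigr => k _.
by rewrite /= derivM !mxE.
Qed.

(** [M] need not commute with its derivative, but the trace is cyclic, so the [k.+1] terms of the
    Leibniz rule have equal traces. *)
Lemma deriv_mxtrace_expr M k :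
  (\tr (M ^+ k.+1))^`() = (\tr (map_mx (@deriv R) M * M ^+ k)) *+ k.+1.
Proof.
have trE N : (\tr N)^`() = \tr (dmx N).
  by rewrite /mxtrace raddf_sum; apply: eq_bigr => i _; rewrite mxE.
have trC (P Q : 'M[{poly R}]_n.+1) : \tr (P * Q) = \tr (Q * P).
  exact: mxtrace_mulC.
(* The spare factor [M ^+ i] absorbs the copies of [M] that cyclicity carries to the right. *)
have H j i : \tr (dmx (M ^+ j.+1) * M ^+ i) = \tr (dmx M * M ^+ (j + i)) *+ j.+1.
  elim: j i => [|j IH] i; first by rewrite expr1.
  rewrite [M ^+ j.+2]exprS dmxM mulrDl linearD/= -!mulrA -exprD.
  by rewrite (trC M) -mulrA -exprSr IH addnS addSn -mulrS.
by rewrite trE -[dmx _]mulr1 -[X in _ * X](expr0 M) H addn0.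
Qed.
End DerivPolyMatrix.

Section TraceInequality.
Variables (R : realType) (n : nat) (A : 'M[R]_n.+1) (u : 'cV[R]_n.+1).
Hypothesis A_sym : A^T = A.
Hypothesis u_unit : (u^T *m u) ord0 ord0 = 1.

Let J : 'M[R]_n.+1 := u *m u^T.
Let d : R := (u^T *m A *m u) ord0 ord0.

(* Integrate d/ds tr (A - s u u^T)^m = - m u^T (A - s u u^T)^(m-1) u over
   [0, 1] and bound the integrand below by (d - s)^(m-1). *)
Lemma mxtrace_rank1_le (k : nat) :
  d ^+ (2 * k).+1 - (d - 1) ^+ (2 * k).+1 <=
  \tr (A ^+ (2 * k).+1) - \tr ((A - J) ^+ (2 * k).+1).
Proof.
set m := (2 * k).+1.
pose M : 'M[{poly R}]_n.+1 := map_mx polyC A - 'X *: map_mx polyC J.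
(* The integration is replaced by monotonicity of a polynomial in s: the claim is q(0) <= q(1), and
   q' is nonnegative by [form_expr_even]. *)
pose q : {poly R} := (d%:P - 'X) ^+ m - \tr (M ^+ m).
have evM s : map_mx (horner_eval s) M = A - s *: J.
  by apply/matrixP => i j; rewrite !mxE /horner_eval !hornerE.
have evtr s N : (\tr N).[s] = \tr (map_mx (horner_eval s) N).
  by rewrite /mxtrace horner_sum; apply: eq_bigr => i _; rewrite mxE.
have evX s j : map_mx (horner_eval s) (M ^+ j) = (A - s *: J) ^+ j.
  by rewrite rmorphXn/= evM.
have qE s : q.[s] = (d - s) ^+ m - \tr ((A - s *: J) ^+ m).
  by rewrite /q !hornerE evtr evX.
have dM : map_mx (@deriv R) M = - map_mx polyC J.
  by apply/matrixP => i j; rewrite !mxE derivB derivM derivX !derivC mul1r mulr0 addr0 sub0r.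
have dq s : 0 <= q^`().[s].
  rewrite /q derivB deriv_mxtrace_expr deriv_exp dM derivB derivC derivX sub0r.
  rewrite hornerD hornerN !hornerMn evtr hornerM horner_exp !hornerE.
  have -> : map_mx (horner_eval s) (- map_mx polyC J * M ^+ (2 * k)) =
            - (J *m (A - s *: J) ^+ (2 * k)).
    rewrite map_mxM evX -mulNmx; congr (_ *m _).
    by apply/matrixP => i j; rewrite !mxE /= /horner_eval !hornerE.
  set N := A - s *: J.
  have NT : N^T = N.
    by rewrite /N linearB/= linearZ/= A_sym /J trmx_mul trmxK.
  have uN : (u^T *m N *m u) ord0 ord0 = d - s.
    have -> : u^T *m N *m u =
        u^T *m A *m u - s *: ((u^T *m u) *m (u^T *m u)).
      by rewrite /N mulmxBr mulmxBl -scalemxAr -scalemxAl /J !mulmxA.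
    rewrite [LHS]mxE -/d; congr (d + _).
    by rewrite [LHS]mxE [X in - X]mxE [X in s * X]mxE big_ord1 u_unit !mulr1.
  have := form_expr_even NT k u_unit.
  rewrite uN => le.
  rewrite linearN/=.
  have -> : \tr (J *m N ^+ (2 * k)) = (u^T *m N ^+ (2 * k) *m u) ord0 ord0.
    by rewrite /J -mulmxA mxtrace_mulC /mxtrace big_ord1.
  by rewrite mulN1r !mulNrn opprK addrC -mulrnBl mulrn_wge0// subr_ge0.
have := @ler_hornerW _ 0 1 q (fun x _ => dq x) 0 1.
rewrite !in_itv/= !lexx ler01 => /(_ isT isT isT).
by rewrite !qE scale0r scale1r !subr0 => le; lra.
Qed.

End TraceInequality.

(** * Densities of odd cycles *)

Section ClosedWalks.
Variables (R : realType) (n : nat) (M : 'M[R]_n.+1).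
Local Notation V := 'I_n.+1.

(** The default value of [nth] is read exactly at the last index, which makes [b] the end of the
    walk. *)
Let walk (a : V) (s : seq V) (b : V) : R :=
  \prod_(i < (size s).+1) M (nth b (a :: s) i) (nth b (a :: s) i.+1).

Let walk_cons a c s b : walk a (c :: s) b = M a c * walk c s b.
Proof. by rewrite /walk big_ord_recl. Qed.

Let sum_tuple_cons k (F : seq V -> R) :
  \sum_(s : k.+1.-tuple V) F s = \sum_c \sum_(s : k.-tuple V) F (c :: s).
Proof.
rewrite pair_bigA /= (reindex (fun p : V * k.-tuple V => [tuple of p.1 :: p.2])) //=.
exists (fun s : k.+1.-tuple V => (thead s, [tuple of behead s])) => [[c s]|s] _.
  by congr (_, _); apply: val_inj.
by apply: val_inj; rewrite /= [in RHS](tuple_eta s).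
Qed.

Let sum_walk k a b : \sum_(s : k.-tuple V) walk a s b = (M ^+ k.+1) a b.
Proof.
elim: k a => [|k IH] a.
  rewrite (big_pred1 [tuple]) => [|s]; last by rewrite (tuple0 s) /= eqxx.
  by rewrite /walk big_ord1 expr1.
rewrite (sum_tuple_cons _ (fun s => walk a s b)) exprS mxE.
apply: eq_bigr => c _; rewrite -IH mulr_sumr.
by apply: eq_bigr => s _; rewrite walk_cons.
Qed.

Lemma sum_closed_walks k :
  \sum_(phi : {ffun 'I_k.+1 -> V}) \prod_i M (phi i) (phi (ordS i)) =
  \tr (M ^+ k.+1).
Proof.
pose h (p : V * k.-tuple V) : {ffun 'I_k.+1 -> V} :=
  [ffun i : 'I_k.+1 => nth p.1 (p.1 :: p.2) i].
rewrite (reindex h) /=; last first.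
  exists (fun phi : {ffun 'I_k.+1 -> V} =>
            (phi ord0, [tuple phi (lift ord0 j) | j < k])) => [[a s]|phi] _.
    rewrite ffunE /=; congr (_, _); apply: eq_from_tnth => j.
    by rewrite tnth_mktuple ffunE /= (tnth_nth a).
  apply/ffunP => i; rewrite ffunE /=; case: (unliftP ord0 i) => [j|] ->//=.
  by rewrite add0n (nth_map j) ?size_enum_ord// nth_ord_enum.
rewrite /mxtrace; under [RHS]eq_bigr do rewrite -sum_walk.
rewrite pair_bigA; apply: eq_bigr => -[a s] _; rewrite /walk size_tuple.
apply: eq_bigr => i _; rewrite !ffunE /=; congr (M _ _).
(* At the last index [ordS] wraps around to 0, where [phi] is [a], and the walk reads its default,
   which is [a] as well. *)
have := ltn_ord i; rewrite ltnS leq_eqVlt => /orP[/eqP->|ik].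
  by rewrite modnn /= nth_default ?size_tuple.
by rewrite modn_small.
Qed.

End ClosedWalks.

Section CycleDensity.
Variables (R : realType) (m : nat).
Hypothesis m_ge3 : (3 <= m)%N.

Lemma cycle_adjE (i j : cycle_graph m) :
  adj i j = (j == ordS i) || (j == ord_pred i).
Proof.
have m_gt0 : (0 < m)%N by apply: leq_trans m_ge3.
have -> : (j == ord_pred i) = (i == ordS j).
  by rewrite -(inj_eq (can_inj (@ordSK m))) ord_predK eq_sym.
rewrite /adj /= /cycle_adj; have [->|//] := eqVneq i j.
rewrite orbb; apply/esym/negbTE.
have := ltn_ord j; rewrite leq_eqVlt => /orP[/eqP jm|jm].
  by rewrite jm modnn; apply/eqP => j0; move: m_ge3; rewrite -jm j0.
by rewrite modn_small// neq_ltn ltnSn.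
Qed.

(** The two neighbours of a vertex coincide only if [m] divides 2; for [m >= 3] each vertex
    therefore has exactly two factors in the squared edge product. *)
Lemma ordS_neq_pred (i : 'I_m) : ordS i != ord_pred i.
Proof.
have m_gt0 : (0 < m)%N by apply: leq_trans m_ge3.
rewrite -(inj_eq (can_inj (@ordSK m))) ord_predK -(inj_eq (@ord_inj m)) /=.
rewrite -[(i.+1 %% m).+1]addn1 modnDml addn1.
apply/negP; rewrite -{2}(modn_small (ltn_ord i)).
rewrite -addn2 -{2}[nat_of_ord i]addn0 eqn_modDl mod0n.
by rewrite modn_small// (leq_trans _ m_ge3).
Qed.

Lemma edge_prod_cycle (U : Type) (w : U -> U -> R) (phi : cycle_graph m -> U) :
  (forall x y, w x y = w y x) -> (forall x y, 0 <= w x y) ->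
  edge_prod w phi = \prod_(i : 'I_m) w (phi i) (phi (ordS i)).
Proof.
move=> w_sym w_ge0; apply: (@pexpIrn _ 2) => //; rewrite ?nnegrE ?prodr_ge0//.
rewrite edge_prodE edge_prod_on_sqr//.
transitivity (\prod_(i : 'I_m) \prod_(j | adj (i : cycle_graph m) j) w (phi i) (phi j)).
  by rewrite pair_big_dep; apply: eq_bigl => p; rewrite !inE !andbT.
transitivity (\prod_(i : 'I_m) (w (phi i) (phi (ordS i)) * w (phi i) (phi (ord_pred i)))).
  apply: eq_bigr => i _.
  rewrite (eq_bigl _ _ (cycle_adjE i)) (bigD1 (ordS i)) ?eqxx//=.
  rewrite (bigD1 (ord_pred i)) /=; last by rewrite eqxx orbT eq_sym ordS_neq_pred.
  rewrite big_pred0 ?mulr1// => j.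
  by case: (j == ordS i); case: (j == ord_pred i).
rewrite big_split expr2 /=; congr (_ * _).
rewrite (reindex_inj (can_inj (@ordSK m))) /=.
by apply: eq_bigr => i _; rewrite ordSK w_sym.
Qed.

(** The constant weight 2 turns the edge product into a power of 2 whose exponent is the number of
    edges. *)
Lemma nedges_cycle : nedges (cycle_graph m) = m.
Proof.
have := @edge_prod_cst R unit (cycle_graph m) (fun _ => tt) 2.
rewrite edge_prod_cycle// prodr_const card_ord => E.
by apply/esym; apply: (ieexprIn _ _ E); rewrite ?ltr0n ?pnatr_eq1.
Qed.

End CycleDensity.

Section OddCycle.
Variables (R : realType) (n m : nat) (w : 'I_n.+1 -> 'I_n.+1 -> R).
Hypotheses (m_ge3 : (3 <= m)%N).
Hypothesis w_sym : forall x y, w x y = w y x.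
Hypothesis w_ge0 : forall x y, 0 <= w x y.

Definition weight_mx : 'M[R]_n.+1 := \matrix_(i, j) (w i j / n.+1%:R).

Lemma dens_cycle : dens w (cycle_graph m) = \tr (weight_mx ^+ m).
Proof.
have -> : m = m.-1.+1 by rewrite prednK// (leq_trans _ m_ge3).
rewrite -sum_closed_walks /dens /avg mulr_suml prednK ?(leq_trans _ m_ge3)//.
apply: eq_bigr => phi _; rewrite edge_prod_cycle// !card_ord natrX -exprVn.
have -> : n.+1%:R^-1 ^+ m = \prod_(i < m) (n.+1%:R^-1 : R).
  by rewrite prodr_const card_ord.
by rewrite -big_split; apply: eq_bigr => i _; rewrite mxE.
Qed.
End OddCycle.

Lemma goodman_odd_cycle (R : realType) (n m : nat) (w1 w2 : 'I_n.+1 -> 'I_n.+1 -> R) :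
  (3 <= m)%N -> odd m ->
  (forall x y, w1 x y = w1 y x) -> (forall x y, w2 x y = w2 y x) ->
  (forall x y, 0 <= w1 x y) -> (forall x y, 0 <= w2 x y) ->
  (forall x y, w1 x y + w2 x y = 1) ->
  edge_dens w1 ^+ m + edge_dens w2 ^+ m <=
  dens w1 (cycle_graph m) + dens w2 (cycle_graph m).
Proof.
move=> m3 m_odd s1 s2 p1 p2 w12; rewrite !dens_cycle//.
have n0 : (n.+1%:R : R) != 0 by rewrite pnatr_eq0.
(* With this entry the constant vector [u] has norm 1, and u u^T has all entries 1 / n.+1, like the
   sum of the two weight matrices. *)
pose a : R := Num.sqrt (n.+1%:R^-1).
have aa : a * a = n.+1%:R^-1 by rewrite -expr2 sqr_sqrtr// invr_ge0.
pose u : 'cV[R]_n.+1 := const_mx a.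
have u1 : (u^T *m u) ord0 ord0 = 1.
  rewrite mxE (eq_bigr (fun _ => n.+1%:R^-1)) => [|i _]; last by rewrite !mxE.
  by rewrite sumr_const card_ord -[_^-1 *+ _]mulr_natr mulVf.
have A1s : (weight_mx w1)^T = weight_mx w1.
  by apply/matrixP => i j; rewrite !mxE s1.
have dE : (u^T *m weight_mx w1 *m u) ord0 ord0 = edge_dens w1.
  rewrite mxE /edge_dens exchange_big card_ord natrX expr2 invfM mulrA !mulr_suml.
  apply: eq_bigr => j _; rewrite !mxE !mulr_suml.
  by apply: eq_bigr => i _; rewrite !mxE mulrAC aa mulrC.
have d2 : edge_dens w2 = 1 - edge_dens w1.
  have V0 : (0 < #|'I_n.+1|)%N by rewrite card_ord.
  by rewrite -(edge_densD V0 w12) addrC addKr.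
have A2 : weight_mx w2 = - (weight_mx w1 - u *m u^T).
  apply/matrixP => i j; rewrite !mxE big_ord1 !mxE aa.
  have -> : w2 i j = 1 - w1 i j by rewrite -(w12 i j) addrC addKr.
  by field.
have [k mE] : exists k, m = (2 * k).+1.
  by exists m./2; rewrite mul2n -[LHS]odd_double_half m_odd.
(* Since [m] is odd, the sign in [A2] comes out of both powers: the subtracted trace becomes the
   cycle density of [w2], and (d - 1)^m becomes minus the m-th power of its edge density. *)
have := mxtrace_rank1_le A1s u1 k; rewrite -mE dE A2 d2.
have oppX (x : R) : (- x) ^+ m = - x ^+ m.
  by rewrite exprNn -signr_odd m_odd expr1 mulN1r.
have oppM (N : 'M[R]_n.+1) : (- N) ^+ m = - N ^+ m.
  by rewrite exprNn -signr_odd m_odd expr1 mulN1r.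
by rewrite oppM linearN/= -(opprB (edge_dens w1)) oppX.
Qed.

(** * Entropy *)

Section Entropy.
Variables (R : realType) (V F : finType) (mu : {ffun F -> V} -> R).
Hypothesis mu_ge0 : forall phi, 0 <= mu phi.
Hypothesis mu_sum1 : \sum_phi mu phi = 1.
Implicit Types (S : {set F}) (phi psi : {ffun F -> V}).

Definition agree S phi psi : bool := [forall (u | u \in S), phi u == psi u].

Lemma agreeP S phi psi : reflect {in S, phi =1 psi} (agree S phi psi).
Proof.
apply: (iffP forall_inP) => [H u uS|H u uS]; first exact/eqP/H.
exact/eqP/H.
Qed.

Lemma agree_refl S phi : agree S phi phi.
Proof. exact/agreeP. Qed.

Lemma agree_sym S phi psi : agree S phi psi = agree S psi phi.
Proof. by apply: eq_forallb => u; rewrite eq_sym. Qed.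

Lemma agree_trans S phi psi chi :
  agree S phi psi -> agree S psi chi -> agree S phi chi.
Proof. by move=> /agreeP H1 /agreeP H2; apply/agreeP => u uS; rewrite H1 ?H2. Qed.

Lemma agree_left S phi psi chi :
  agree S phi psi -> agree S phi chi = agree S psi chi.
Proof.
move=> H; apply/idP/idP; apply: agree_trans => //; by rewrite agree_sym.
Qed.

Lemma agree_sub S S' phi psi :
  S \subset S' -> agree S' phi psi -> agree S phi psi.
Proof. by move=> /fintype.subsetP SS' /agreeP H; apply/agreeP => u /SS'/H. Qed.

(* The probability that a mu-random map coincides with phi on S. *)
Definition marg S phi : R := \sum_(psi | agree S phi psi) mu psi.

(** The Shannon entropy of the restriction to [S] of a mu-random map, kept as an expectation over
    maps of the whole of [F] so that no partial maps are needed. *)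
Definition ent S : R := - \sum_phi mu phi * ln (marg S phi).

Lemma le_marg S phi : mu phi <= marg S phi.
Proof. by rewrite /marg (bigD1 phi) ?agree_refl//= lerDl sumr_ge0. Qed.

Lemma marg_ge0 S phi : 0 <= marg S phi.
Proof. exact: le_trans (mu_ge0 phi) (le_marg S phi). Qed.

Lemma marg_gt0 S phi : mu phi != 0 -> 0 < marg S phi.
Proof. by move=> H; apply: lt_le_trans (le_marg S phi); rewrite lt_neqAle eq_sym H mu_ge0. Qed.

Lemma marg_agree S phi psi : agree S phi psi -> marg S phi = marg S psi.
Proof. by move=> H; apply: eq_bigl => chi; rewrite (agree_left _ H). Qed.

Lemma ent0 : ent finset.set0 = 0.
Proof.
rewrite /ent big1 ?oppr0// => phi _; rewrite /marg (eq_bigl xpredT).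
  by rewrite mu_sum1 ln1 mulr0.
by move=> psi; apply/agreeP => u; rewrite inE.
Qed.

(** Nonnegativity of the conditional mutual information of the values on [R1] and [R3] given those
    on [R2]. As ln r <= r - 1, it is enough that the likelihood ratio [r], of the conditionally
    independent law to the true one, has expectation at most 1. *)
Lemma ent_submodular (R1 R2 R3 : {set F}) :
  ent (R1 :|: R2 :|: R3) - ent (R2 :|: R3) - ent (R1 :|: R2) + ent R2 <= 0.
Proof.
set S := R1 :|: R2 :|: R3; set S23 := R2 :|: R3; set S12 := R1 :|: R2.
have s2_12 : R2 \subset S12 by exact: finset.subsetUr.
have s2_23 : R2 \subset S23 by exact: finset.subsetUl.
have cancel_le1 (x : R) : x / x <= 1.
  by have [->|x0] := eqVneq x 0; [rewrite mul0r ler01|rewrite divff].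
pose r phi := marg S12 phi * marg S23 phi / (marg S phi * marg R2 phi).
suff r_le1 : \sum_phi mu phi * r phi <= 1.
  rewrite /ent !opprK.
  apply: (@le_trans _ _ (\sum_phi (mu phi * r phi - mu phi))); last first.
    by rewrite sumrB mu_sum1 subr_le0.
  rewrite -sumrN -!big_split/= -sumrN -big_split /=; apply: ler_sum => phi _.
  have [->|mu0] := eqVneq (mu phi) 0; first by rewrite !mul0r oppr0 !addr0.
  have [g g12 g23 g2] := And4 (marg_gt0 S mu0) (marg_gt0 S12 mu0)
    (marg_gt0 S23 mu0) (marg_gt0 R2 mu0).
  have -> : - (mu phi * ln (marg S phi)) + mu phi * ln (marg S23 phi) +
     mu phi * ln (marg S12 phi) - mu phi * ln (marg R2 phi) = mu phi * ln (r phi).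
    rewrite /r ln_div ?posrE ?mulr_gt0// !lnM ?posrE//; ring.
  rewrite -[X in _ - X]mulr1 -mulrBr ler_wpM2l//.
  have -> : r phi = 1 + (r phi - 1) by ring.
  rewrite [1 + _ - 1]addrAC subrr add0r le_ln1Dx// ltrBrDr addNr /r.
  by rewrite divr_gt0 ?mulr_gt0.
(* All such [phi] coincide on S, the union of S12 and S23; they share one value of [marg S], and
   their masses add up to at most that value. *)
have fiber x y : \sum_(phi | agree S12 phi x && agree S23 phi y)
    mu phi / marg S phi <= 1.
  case: (pickP (fun phi => agree S12 phi x && agree S23 phi y)) => [phi0 P0|P0]; last first.
    by rewrite big_pred0// ler01.
  have sub phi : agree S12 phi x && agree S23 phi y -> agree S phi0 phi.
    case/andP: P0 => /agreeP p1 /agreeP p2 /andP[/agreeP p3 /agreeP p4].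
    apply/agreeP => u; rewrite /S -finset.setUA 2!inE -/S23 => /orP[uS|uS].
      by rewrite p1 ?p3// inE uS.
    by rewrite p2 ?p4// inE.
  apply: (@le_trans _ _ (\sum_(phi | agree S phi0 phi) mu phi / marg S phi0)).
    rewrite [X in _ <= X](bigID (fun phi => agree S12 phi x && agree S23 phi y))/=.
    rewrite -[X in X <= _]addr0 lerD//; last first.
      by apply: sumr_ge0 => phi _; rewrite divr_ge0// marg_ge0.
    rewrite le_eqVlt; apply/orP; left; apply/eqP; apply: eq_big => phi.
      by case H: (_ && _); rewrite ?andbF// andbT (sub _ H).
    by move=> /sub/marg_agree->.
  by rewrite -mulr_suml cancel_le1.
apply: (@le_trans _ _ (\sum_x \sum_(y | agree R2 x y) mu x * mu y / marg R2 x)); last first.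
  rewrite -mu_sum1; apply: ler_sum => x _.
  under eq_bigr do rewrite mulrAC -mulrA.
  by rewrite -!mulr_sumr ler_piMr// mulrC cancel_le1.
(* The two marginals in the numerator of [r] are expanded over maps [x] and [y]. Only pairs that
   agree on [R2] are joined by some [phi], and [fiber] bounds their inner sum. *)
have -> : \sum_phi mu phi * r phi = \sum_x \sum_y \sum_(phi | agree S12 phi x && agree S23 phi y)
   mu x * mu y * (mu phi / marg S phi) / marg R2 phi.
  transitivity (\sum_phi \sum_x \sum_(y | agree S12 phi x && agree S23 phi y)
      mu x * mu y * (mu phi / marg S phi) / marg R2 phi); last first.
    rewrite exchange_big; apply: eq_bigr => x _.
    by rewrite [RHS](exchange_big_dep xpredT).
  apply: eq_bigr => phi _.
  transitivity (marg S12 phi * marg S23 phi * (mu phi / marg S phi / marg R2 phi)).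
    by rewrite /r invfM mulrCA !mulrA.
  rewrite {1 2}/marg big_distrlr /= mulr_suml big_mkcond; apply: eq_bigr => x _.
  case: ifP => _; last by rewrite big_pred0.
  by rewrite mulr_suml; apply: eq_bigr => y _; rewrite !mulrA.
apply: ler_sum => x _; rewrite [X in _ <= X]big_mkcond; apply: ler_sum => y _.
case: ifPn => [xy|/negP nxy].
  rewrite (eq_bigr (fun phi => mu x * mu y / marg R2 x * (mu phi / marg S phi))).
    by rewrite -mulr_sumr ler_piMr ?fiber// divr_ge0 ?mulr_ge0 ?marg_ge0.
  move=> phi /andP[/(agree_sub s2_12)/marg_agree-> _].
  by rewrite mulrAC.
rewrite big_pred0// => phi; apply/negP => /andP[/(agree_sub s2_12) H1 /(agree_sub s2_23) H2].
by apply: nxy; rewrite -(agree_left _ H1).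
Qed.

End Entropy.

(** * Random gluing along a tree *)

(** The part [A] grows by one leaf at a time and stays connected within itself. A second neighbour
    of [t] in [A] would be joined to [s] by a simple path inside [A], and closing this path through
    [t] gives a cycle on at least three vertices. *)
Lemma tree_ind (T : sgraph) (P : {set T} -> Prop) : is_tree T ->
  (forall s, P [set s]) ->
  (forall (A : {set T}) s t, P A -> s \in A -> t \notin A -> adj s t ->
     (forall s', s' \in A -> adj s' t -> s' = s) -> P (t |: A)) ->
  P [set: T].
Proof.
move=> [T_gt0 T_conn T_acyc] P1 PS.
pose inner (A : {set T}) := [rel x y | [&& adj x y, x \in A & y \in A]] : rel T.
pose conn (A : {set T}) := {in A &, forall x y, connect (inner A) x y}.
suff H k : (k < #|T|)%N -> exists A : {set T}, [/\ #|A| = k.+1, conn A & P A].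
  have [A [cA _ PA]] := H #|T|.-1 (ltac:(by rewrite prednK)).
  suff -> : [set: T] = A by [].
  by apply/esym/eqP; rewrite finset.eqEcard finset.subsetT cardsT cA prednK ?leqnn.
elim: k => [|k IH] kT.
  have /card_gt0P[s _] := T_gt0; exists [set s]; split=> //; first by rewrite cards1.
  by move=> x y; rewrite !inE => /eqP-> /eqP->.
have [A [cA Aconn PA]] := IH (ltnW kT).
have /existsP[[s t] /and3P[/= sA tA st]] :
    [exists p : T * T, [&& p.1 \in A, p.2 \notin A & adj p.1 p.2]].
  apply: contraT => /existsPn H; exfalso.
  have cl : fingraph.closed (@adj T) (mem A).
    apply: (intro_closed (sym_connect_sym (@adj_sym T))) => x y xy xA.
    by apply/negPn/negP => yA; have := H (x, y); rewrite /= xA xy yA.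
  have /card_gt0P[x xA] : (0 < #|A|)%N by rewrite cA.
  have : [set: T] \subset A.
    apply/fintype.subsetP => y _.
    by have <- : (x \in A) = (y \in A) := closed_connect cl (T_conn x y).
  by move=> /subset_leq_card; rewrite cardsT cA leqNgt kT.
have tNA a : a \in A -> a != t by apply: contraTneq => ->.
exists (t |: A); split.
- by rewrite cardsU1 tA cA.
- have inc : subrel (inner A) (connect (inner (t |: A))).
    by move=> x y /and3P[xy xA yA]; apply: connect1; rewrite /inner /= xy !inE xA yA !orbT.
  have stc : inner (t |: A) s t by rewrite /inner /= st !inE sA eqxx orbT.
  have symc : connect_sym (inner (t |: A)).
    by apply: sym_connect_sym => x y; rewrite /inner /= adj_sym [X in _ && X]andbC.
  have toS x : x \in t |: A -> connect (inner (t |: A)) s x.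
    rewrite !inE => /orP[/eqP->|xA]; first exact: connect1.
    exact: (connect_sub inc (Aconn s x sA xA)).
  by move=> x y /toS sx /toS sy; apply: connect_trans sy; rewrite symc.
- apply: (PS A s t) => // s' s'A s't; apply/eqP/negPn/negP => s'Ns.
  have /connectP[p0 p0path p0last] := Aconn s s' sA s'A.
  case: (shortenP p0path) p0last => p ppath puniq _ plast.
  have pA : {subset p <= A}.
    move=> x; elim: p s {sA st s'Ns puniq plast p0path} ppath => //= y p IHp s.
    by case/andP=> /and3P[_ _ yA] yp; rewrite inE => /orP[/eqP->//|]; exact: IHp yp.
  have : ucycle (@adj T) (t :: s :: p).
    apply/andP; split.
      rewrite /= adj_sym st rcons_path -plast s't andbT /=.
      by apply: sub_path ppath => x y /and3P[].
    rewrite cons_uniq puniq andbT inE negb_or eq_sym tNA//=.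
    by apply: contra tA; exact: pA.
  move=> /T_acyc /=; rewrite !ltnS leqn0 => /nilP pE; move: plast s'Ns.
  by rewrite pE /= => ->; rewrite eqxx.
Qed.

Lemma big_edges_setU1 (M : Type) (idx : M) (op : Monoid.com_law idx)
    (T : sgraph) (A : {set T}) (s t : T) (f : {set T} -> M) :
  s \in A -> t \notin A -> adj s t ->
  (forall s', s' \in A -> adj s' t -> s' = s) ->
  \big[op/idx]_(e in edges T | e \subset t |: A) f e =
  op (f [set s; t]) (\big[op/idx]_(e in edges T | e \subset A) f e).
Proof.
move=> sA tA st s_uniq; rewrite (bigD1 [set s; t]) /=; last first.
  rewrite finset.subUset !finset.sub1set !inE sA eqxx orbT andbT.
  by apply/imsetP; exists (s, t).
congr (op _ _); apply: eq_bigl.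
move=> e0; case e0T: (e0 \in edges T) => //=.
case/imsetP: e0T => -[x y]; rewrite inE /= => xy ->.
rewrite !finset.subUset !finset.sub1set !inE.
have [xt|xt] := eqVneq x t; have [yt|yt] := eqVneq y t => /=.
+ by move: xy; rewrite xt yt adj_irrefl.
+ rewrite xt (negbTE tA) /=; apply/negbTE; rewrite negb_and negbK -implybE.
  apply/implyP => yA; have -> : y = s by apply: s_uniq; rewrite // -xt adj_sym.
  by rewrite finset.setUC.
+ rewrite yt (negbTE tA) andbF andbT; apply/negbTE; rewrite negb_and negbK -implybE.
  by apply/implyP => xA; have -> : x = s by apply: s_uniq; rewrite // -yt.
+ rewrite -[RHS]andbT; congr (_ && _).
  apply/eqP => /setP/(_ t); rewrite !inE eqxx orbT.
  by rewrite !(eq_sym t) (negbTE xt) (negbTE yt).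
Qed.

Section TreeLaw.
Variables (R : realType) (V : finType) (F : sgraph) (P : template F).
Variables (mu : {ffun F -> V} -> R) (v0 : V).
Hypothesis mu_ge0 : forall phi, 0 <= mu phi.
Local Notation T := (tree P).

Definition row_at (G : {ffun T * F -> V}) (s : T) : {ffun F -> V} :=
  [ffun v => G (s, v)].

Definition local (S : {set F}) (h : {ffun F -> V} -> R) :=
  forall phi psi, agree S phi psi -> h phi = h psi.

(* nu is the law of the random gluing, along the part A of the tree, of
   copies of a mu-random map that are conditionally independent given their
   values on the sets psi(st); v0 fills the irrelevant entries. *)
Definition tree_law (A : {set T}) (nu : {ffun T * F -> V} -> R) : Prop :=
  [/\ forall G, 0 <= nu G,
      forall s h, s \in A -> local (psiV P s) h ->
        \sum_G nu G * h (row_at G s) = \sum_phi mu phi * h phi,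
      forall G, nu G != 0 ->
        (forall p, ~~ ((p.1 \in A) && (p.2 \in psiV P p.1)) -> G p = v0) /\
        (forall s t v, s \in A -> t \in A -> adj s t ->
           v \in psiE P [set s; t] -> G (s, v) = G (t, v)) &
      - \sum_G nu G * ln (nu G) =
        \sum_(s in A) ent mu (psiV P s) -
        \sum_(e in edges T | e \subset A) ent mu (psiE P e)].

Lemma sum_pushforward (I J : finType) (K : I -> R) (g : I -> J) (f : J -> R) :
  \sum_j (\sum_(i | g i == j) K i) * f j = \sum_i K i * f (g i).
Proof.
under eq_bigr do rewrite mulr_suml.
rewrite (exchange_big_dep xpredT)//=; apply: eq_bigr => i _.
by rewrite (big_pred1 (g i))// => j; rewrite /= eq_sym.
Qed.

Let upd (t : T) (G : {ffun T * F -> V}) (phi : {ffun F -> V}) :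
    {ffun T * F -> V} :=
  [ffun p => if p.1 == t then (if p.2 \in psiV P t then phi p.2 else v0)
             else G p].

Let row_upd t G phi : agree (psiV P t) (row_at (upd t G phi) t) phi.
Proof. by apply/agreeP => v vt; rewrite !ffunE /= eqxx vt. Qed.

Let row_upd_neq t G phi s : s != t -> row_at (upd t G phi) s = row_at G s.
Proof. by move=> st; apply/ffunP => v; rewrite !ffunE /= (negbTE st). Qed.

Lemma edges_sub1 (T0 : sgraph) (s : T0) e :
  e \in edges T0 -> e \subset [set s] -> False.
Proof.
move=> /imsetP[[x y]]; rewrite inE /= => xy ->.
rewrite finset.subUset !finset.sub1set !inE => /andP[/eqP xs /eqP ys].
by move: xy; rewrite xs ys adj_irrefl.
Qed.

Lemma tree_law1 (s : T) : exists nu, tree_law [set s] nu.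
Proof.
pose g phi := upd s [ffun=> v0] phi.
pose nu (G : {ffun T * F -> V}) := \sum_(phi | g phi == G) mu phi.
have nu_g phi : nu (g phi) = marg mu (psiV P s) phi.
  apply: eq_bigl => psi; apply/eqP/agreeP => [E v vs|E].
    by have /ffunP/(_ (s, v)) := E; rewrite !ffunE /= eqxx vs.
  apply/ffunP => p; rewrite !ffunE; case: eqP => // _; case: ifP => // ps.
  by rewrite E.
exists nu; split.
- by move=> G; rewrite sumr_ge0.
- move=> s' h; rewrite inE => /eqP-> hloc; rewrite sum_pushforward.
  by apply: eq_bigr => phi _; rewrite (hloc _ phi (row_upd _ _ _)).
- move=> G nuG; have [phi /eqP <-] : exists phi, g phi == G.
    apply/existsP; apply: contraNT nuG => /existsPn H.
    by rewrite /nu big_pred0// => phi; apply/negbTE/H.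
  split=> [[s' v]|s1 s2 v]; rewrite !inE /=.
    rewrite !ffunE /=; case: eqP => //= ->; by case: ifP.
  by move=> /eqP-> /eqP->; rewrite adj_irrefl.
- rewrite sum_pushforward big_set1 [X in _ = _ - X]big_pred0 ?subr0.
    by rewrite /ent; congr (- _); apply: eq_bigr => phi _; rewrite nu_g.
  move=> e; apply/negP => /andP[]; exact: edges_sub1.
Qed.

(** The copy at [t] is drawn from mu conditioned on the values that the copy at [s] takes on
    psi(st). By the chain rule it adds the entropy of psi(t) minus that of psi(st). *)
Lemma tree_law_step (A : {set T}) s t nu :
  tree_law A nu -> s \in A -> t \notin A -> adj s t ->
  (forall s', s' \in A -> adj s' t -> s' = s) ->
  exists nu', tree_law (t |: A) nu'.
Proof.
move=> [nu_ge0 nu_marg nu_supp nu_ent] sA tA st s_uniq.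
set e := psiE P [set s; t].
have /andP[es et] : (e \subset psiV P s) && (e \subset psiV P t).
  by rewrite -finset.subsetI; exact: psi_sub.
have sNt : s != t by apply: contraNneq tA => <-.
(* The joint law of the old array and the fresh copy. The new array is the image of this pair under
   [g], which overwrites row [t]. *)
pose K (q : {ffun T * F -> V} * {ffun F -> V}) : R :=
  nu q.1 * (mu q.2 * (agree e (row_at q.1 s) q.2)%:R / marg mu e (row_at q.1 s)).
pose g q := upd t q.1 q.2.
pose nu' (G : {ffun T * F -> V}) := \sum_(q | g q == G) K q.
have K_ge0 q : 0 <= K q.
  by rewrite !mulr_ge0// ?invr_ge0 ?marg_ge0//.
(* The indicator of a vanishing marginal has mu-expectation 0, hence nu-expectation 0, as row [s]
   has the marginal of mu on psi(s). *)
have margs_neq0 G : nu G != 0 -> marg mu e (row_at G s) != 0.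
  move=> nuG; pose h phi : R := (marg mu e phi == 0)%:R.
  have hl : local (psiV P s) h.
    by move=> phi psi /(agree_sub es)/marg_agree E; rewrite /h E.
  have := nu_marg s h sA hl; rewrite [RHS]big1 => [|phi _].
    move/eqP; rewrite psumr_eq0 => [|G' _]; last by rewrite mulr_ge0.
    move=> /allP/(_ G (mem_index_enum _)) /=; rewrite mulf_eq0 (negbTE nuG) /=.
    by rewrite pnatr_eq0 eqb0.
  have [->|mu0] := eqVneq (mu phi) 0; first by rewrite mul0r.
  by rewrite /h gt_eqF ?marg_gt0// mulr0.
have K1 G : \sum_phi K (G, phi) = nu G.
  have [nu0|nuG] := eqVneq (nu G) 0.
    by rewrite nu0 big1// => phi _; rewrite /K nu0 mul0r.
  rewrite /K /= -mulr_sumr -mulr_suml (_ : \sum_i _ = marg mu e (row_at G s)).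
    by rewrite divff ?mulr1// margs_neq0.
  rewrite /marg [RHS]big_mkcond; apply: eq_bigr => phi _ /=.
  by case: ifP; rewrite ?mulr1 ?mulr0.
have K2 h : local (psiV P t) h -> \sum_q K q * h q.2 = \sum_phi mu phi * h phi.
  move=> hl.
  (* The conditional expectation of [h] given the values of [x] on [e]; the tower rule then shows
     that the fresh copy has the marginal of mu. *)
  pose k x : R := \sum_phi mu phi * (agree e x phi)%:R / marg mu e x * h phi.
  have kl : local (psiV P s) k.
    move=> x y /(agree_sub es) xy; apply: eq_bigr => phi _.
    by rewrite (marg_agree _ xy) (agree_left _ xy).
  transitivity (\sum_G nu G * k (row_at G s)).
    rewrite -(pair_bigA _ (fun G phi => K (G, phi) * h phi))/=.
    apply: eq_bigr => G _; rewrite /k mulr_sumr; apply: eq_bigr => phi _.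
    by rewrite /K !mulrA.
  rewrite (nu_marg s k sA kl).
  under eq_bigr do rewrite mulr_sumr.
  rewrite exchange_big /=; apply: eq_bigr => phi _.
  transitivity (\sum_(x | agree e phi x) mu x * (mu phi * h phi / marg mu e phi)).
    rewrite [RHS]big_mkcond; apply: eq_bigr => x _; rewrite (agree_sym e phi).
    case: ifP => [H|_]; last by rewrite mulr0 !mul0r mulr0.
    by rewrite mulr1 (marg_agree _ H); congr (_ * _); rewrite mulrAC.
  rewrite -mulr_suml -/(marg mu e phi).
  have [->|mu0] := eqVneq (mu phi) 0; first by rewrite !mul0r mulr0.
  by rewrite mulrC divfK// gt_eqF ?marg_gt0.
have Kneq0 q : K q != 0 -> nu q.1 != 0 /\ agree e (row_at q.1 s) q.2.
  rewrite /K mulf_eq0 negb_or => /andP[-> H]; split=> //.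
  by apply: contraNT H => /negbTE->; rewrite mulr0 mul0r.
(* Row [t] of [G] is constantly [v0] on the support, as [t] is outside [A]. Overwriting it loses
   nothing, and a fibre of [g] within the support only varies [phi] off psi(t). *)
have nu'_g q : K q != 0 -> nu' (g q) =
    nu q.1 * marg mu (psiV P t) q.2 / marg mu e (row_at q.1 s).
  case: q => G phi Kq; have [/= nuG Gphi] := Kneq0 _ Kq.
  transitivity (\sum_(psi | agree (psiV P t) phi psi) K (G, psi)); last first.
    rewrite /marg mulr_sumr mulr_suml; apply: eq_bigr => psi /(agree_sub et) H.
    by rewrite /K /= (agree_trans Gphi H) mulr1 !mulrA.
  transitivity (\sum_(q | (K q != 0) && (g q == g (G, phi))) K q).
    rewrite /nu' [LHS](bigID (fun q => K q == 0)) /= [X in X + _]big1 ?add0r.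
      by apply: eq_bigl => q; rewrite andbC.
    by move=> q /andP[_ /eqP].
  transitivity (\sum_(psi | agree (psiV P t) phi psi && (K (G, psi) != 0)) K (G, psi)); last first.
    rewrite [RHS](bigID (fun psi => K (G, psi) == 0)) /= [X in _ = X + _]big1 ?add0r//.
    by move=> psi /andP[_ /eqP].
  rewrite (reindex_onto (fun psi => (G, psi)) snd) /=.
    apply: eq_bigl => psi; rewrite eqxx andbT andbC; congr (_ && _).
    apply/eqP/agreeP => [E v vt|E].
      by have /ffunP/(_ (t, v)) := E; rewrite !ffunE /= eqxx vt.
    apply/ffunP => p; rewrite !ffunE; case: eqP => // _; case: ifP => // ps.
    by rewrite E.
  move=> [G1 psi] /andP[/Kneq0[/= nuG1 _] /eqP/ffunP E]; congr (_, _).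
  apply/ffunP => p; have := E p; rewrite !ffunE.
  case: eqP => // pt _.
  have [H1 _] := nu_supp _ nuG1; have [H2 _] := nu_supp _ nuG.
  by rewrite H1 ?H2// pt (negbTE tA).
exists nu'; split.
- by move=> G; rewrite sumr_ge0.
- move=> s' h s'A hl; rewrite sum_pushforward.
  move: s'A; rewrite !inE => /orP[/eqP s't|s'A].
    subst s'; rewrite -(K2 _ hl); apply: eq_bigr => q _.
    by rewrite (hl _ q.2 (row_upd _ _ _)).
  have s'Nt : s' != t by apply: contraNneq tA => <-.
  rewrite -(nu_marg s' h s'A hl).
  rewrite -(pair_bigA _ (fun G phi => K (G, phi) * h (row_at (g (G, phi)) s')))/=.
  apply: eq_bigr => G _; rewrite -[in RHS]K1 mulr_suml; apply: eq_bigr => phi _.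
  by rewrite /g /= row_upd_neq.
- move=> G nuG; have [q /andP[/eqP <- Kq]] : exists q, (g q == G) && (K q != 0).
    apply/existsP; apply: contraNT nuG => /existsPn H.
    rewrite /nu' big1// => q gq; have := H q; rewrite gq /= negbK => /eqP //.
  have [nuG' agr] := Kneq0 _ Kq; have [H1 H2] := nu_supp _ nuG'.
  have agree_st v : v \in e -> q.1 (s, v) = q.2 v.
    by move=> ve; have /agreeP/(_ v ve) := agr; rewrite ffunE.
  split=> [[s' v]|s1 s2 v]; rewrite !inE /=.
    rewrite !ffunE /=; case: eqP => /= [->|_]; first by case: ifP.
    by move=> H; exact: H1.
  rewrite !ffunE /=; case: (eqVneq s1 t) => [->|s1t] /=; case: (eqVneq s2 t) => [->|s2t] //=.
  + move=> _ s2A ts2; have s2s : s2 = s by apply: s_uniq; rewrite // adj_sym.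
    rewrite s2s finset.setUC => ve; rewrite (fintype.subsetP et)//.
    by rewrite agree_st.
  + move=> s1A _ s1t'; have s1s : s1 = s by apply: s_uniq.
    rewrite s1s => ve; rewrite (fintype.subsetP et)//.
    by rewrite agree_st.
  + exact: H2.
- rewrite sum_pushforward.
  transitivity (- (\sum_q K q * ln (nu q.1) + \sum_q K q * ln (marg mu (psiV P t) q.2)
      - \sum_q K q * ln (marg mu e (row_at q.1 s)))).
    congr (- _); rewrite -big_split -sumrB /=; apply: eq_bigr => q _.
    have [->|Kq] := eqVneq (K q) 0; first by rewrite !mul0r subr0 addr0.
    rewrite nu'_g// -mulrDr -mulrBr; congr (_ * _).
    have [nuG _] := Kneq0 _ Kq.
    have mu0 : mu q.2 != 0.
      by apply: contraNneq Kq => H; rewrite /K H !mul0r mulr0.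
    have g1 : 0 < nu q.1 by rewrite lt_neqAle eq_sym nuG nu_ge0.
    have g2 := marg_gt0 mu_ge0 (psiV P t) mu0.
    have g3 : 0 < marg mu e (row_at q.1 s).
      by rewrite lt_neqAle eq_sym margs_neq0// marg_ge0.
    by rewrite ln_div ?lnM ?posrE ?mulr_gt0.
  have fstE f : \sum_q K q * f q.1 = \sum_G nu G * f G.
    rewrite -(pair_bigA _ (fun G phi => K (G, phi) * f G))/=.
    by apply: eq_bigr => G _; rewrite -mulr_suml K1.
  rewrite (fstE (fun G => ln (nu G))) (fstE (fun G => ln (marg mu e (row_at G s)))).
  rewrite (nu_marg s (fun phi => ln (marg mu e phi)) sA); last first.
    by move=> phi psi /(agree_sub es)/marg_agree->.
  rewrite (K2 (fun phi => ln (marg mu (psiV P t) phi))); last first.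
    by move=> phi psi /marg_agree->.
  rewrite big_setU1//= (big_edges_setU1 _ _ sA tA st s_uniq) /=.
  rewrite -/e opprB opprD nu_ent /ent; ring.
Qed.

Lemma exists_tree_law : exists nu, tree_law [set: T] nu.
Proof.
apply: (tree_ind (treeP P) (P := fun A => exists nu, tree_law A nu)).
  exact: tree_law1.
by move=> A s t [nu nuA] sA tA st; apply: tree_law_step nuA sA tA st.
Qed.

End TreeLaw.

(** [B] collects representatives of the classes met so far. A new leaf [t] needs representatives
    only for psi(t) minus psi(st), the other copies being identified with copies at [s]. An upper
    bound suffices, since |V| to the number of vertices is the denominator of the density. *)
Lemma card_glued (F : sgraph) (P : template F) :
  (#|glued P| + \sum_(e in edges (tree P)) #|psiE P e| <=
   \sum_(s : tree P) #|psiV P s|)%N.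
Proof.
pose Q (A : {set tree P}) := exists B : {set tree P * F},
  (#|B| + \sum_(e in edges (tree P) | e \subset A) #|psiE P e| <=
     \sum_(s in A) #|psiV P s|)%N /\
  forall p, p.1 \in A -> p \in copies P ->
    exists2 q, q \in B & connect (@identified F P) q p.
suff [B [cB Bcov]] : Q [set: tree P].
  have {}cB : (#|B| + \sum_(e in edges (tree P)) #|psiE P e| <=
      \sum_(s : tree P) #|psiV P s|)%N.
    apply: leq_trans (leq_trans cB _); last first.
      by rewrite leq_eqVlt; apply/orP; left; apply/eqP; apply: eq_bigl => s; rewrite inE.
    rewrite leq_add2l leq_eqVlt; apply/orP; left; apply/eqP; apply: eq_bigl => e.
    by rewrite finset.subsetT andbT.
  apply: leq_trans cB; rewrite leq_add2r.
  pose cl (q : tree P * F) : {set tree P * F} :=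
    [set p in copies P | connect (@identified F P) q p].
  apply: leq_trans (leq_imset_card cl B).
  rewrite card_sig; apply: subset_leq_card; apply/fintype.subsetP => C.
  rewrite unfold_in => /imsetP[p pc ->].
  have [q qB qp] := Bcov p (finset.in_setT _) pc.
  apply/imsetP; exists q => //; apply/setP => r; rewrite !inE; congr (_ && _).
  have isym : connect_sym (@identified F P).
    apply: sym_connect_sym => x y; rewrite /identified adj_sym eq_sym finset.setUC.
    by case: (eqVneq x.2) => // ->.
  by rewrite (same_connect isym qp).
apply: (tree_ind (treeP P)) => [s|A s t [B [cB Bcov]] sA tA st s_uniq].
  exists (finset.setX [set s] (psiV P s)); split.
    rewrite cardsX cards1 mul1n !big_set1 big_pred0 ?addn0// => e.
    by apply/negP => /andP[]; exact: edges_sub1.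
  move=> [s' v]; rewrite inE /= => /eqP-> vs; exists (s, v) => //.
  by move: vs; rewrite !inE /= eqxx.
set e := psiE P [set s; t].
have /andP[es et] : (e \subset psiV P s) && (e \subset psiV P t).
  by rewrite -finset.subsetI; exact: psi_sub.
exists (B :|: finset.setX [set t] (psiV P t :\: e)); split.
  rewrite big_setU1//= (big_edges_setU1 _ _ sA tA st s_uniq) /= -/e.
  have cU := (leq_card_setU B (finset.setX [set t] (psiV P t :\: e))).1.
  rewrite cardsX cards1 mul1n cardsD (finset.setIidPr et) in cU.
  have ce := subset_leq_card et.
  move: cB cU ce; move: #|B| #|_ :|: _| #|e| #|psiV P t|.
  move: (\sum_(_ in _ | _) _)%N (\sum_(_ in _) _)%N => a b c d x y.
  by lia.
have IH p q : connect (@identified F P) p q ->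
    (exists2 r, r \in B & connect (@identified F P) r p) ->
  exists2 r, r \in B :|: finset.setX [set t] (psiV P t :\: e) &
    connect (@identified F P) r q.
  by move=> pq [r rB rp]; exists r; [rewrite inE rB|exact: connect_trans rp pq].
move=> [s' v]; rewrite !inE /= => /orP[/eqP->|s'A] vs; last first.
  by apply: IH (connect0 _ _) (Bcov (s', v) s'A _); rewrite inE.
have [ve|ve] := boolP (v \in e); last first.
  by exists (t, v) => //; rewrite !inE /= eqxx ve vs orbT.
apply: (IH (s, v)); last by apply: (Bcov (s, v) sA); rewrite inE /= (fintype.subsetP es).
by apply: connect1; rewrite /identified /= st eqxx.
Qed.

(** * Gibbs inequality and good templates *)

Lemma ln_prod (R : realType) (I : finType) (Q : pred I) (f : I -> R) :
  (forall i, Q i -> 0 < f i) ->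
  ln (\prod_(i | Q i) f i) = \sum_(i | Q i) ln (f i).
Proof.
move=> f_gt0.
suff [] : 0 < \prod_(i | Q i) f i /\
    ln (\prod_(i | Q i) f i) = \sum_(i | Q i) ln (f i) by [].
elim/big_rec2: _ => [|i x y Qi [y0 <-]]; first by rewrite ln1.
by rewrite lnM ?posrE ?f_gt0//; split=> //; rewrite mulr_gt0 ?f_gt0.
Qed.

(** Apply ln x <= x - 1 to x = a i / (N nu i). The sum is kept on the support of nu because arrays
    are in bijection with maps of the glued graph only there. *)
Lemma gibbs (R : realType) (I : finType) (nu a : I -> R) :
  (forall i, 0 <= nu i) -> \sum_i nu i = 1 ->
  (forall i, nu i != 0 -> 0 < a i) ->
  \sum_i nu i * ln (a i) - \sum_i nu i * ln (nu i) <=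
  ln (\sum_(i | nu i != 0) a i).
Proof.
move=> nu_ge0 nu1 a_gt0; set N := \sum_(i | _) a i.
have N_gt0 : 0 < N.
  have [i nui] : exists i, nu i != 0.
    apply/existsP; apply: contraT => /existsPn H; exfalso.
    have := nu1; rewrite big1 => [/eqP|i _]; first by rewrite eq_sym oner_eq0.
    by apply/eqP; have := H i; rewrite negbK.
  rewrite /N (bigD1 i)//= ltr_pwDl ?a_gt0// sumr_ge0// => j /andP[/a_gt0/ltW//].
rewrite -subr_le0 -[ln N]mul1r -nu1 mulr_suml -!sumrB.
apply: (@le_trans _ _ (\sum_(i | nu i != 0) (a i / N - nu i))).
  rewrite [X in _ <= X]big_mkcond; apply: ler_sum => i _.
  have [->|nui] := eqVneq (nu i) 0; first by rewrite !mul0r !subr0.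
  have nu_gt0 : 0 < nu i by rewrite lt_neqAle eq_sym nui nu_ge0.
  have -> : a i / N - nu i = nu i * (a i / (N * nu i) - 1).
    by field; rewrite nui gt_eqF.
  rewrite -!mulrBr ler_wpM2l//.
  have -> : ln (a i) - ln (nu i) - ln N = ln (1 + (a i / (N * nu i) - 1)).
    rewrite [1 + _]addrC subrK ln_div ?posrE ?mulr_gt0 ?a_gt0// lnM ?posrE//.
    by rewrite opprD addrA addrAC.
  by rewrite le_ln1Dx// ltrBrDr addNr divr_gt0 ?a_gt0 ?mulr_gt0.
rewrite sumrB -mulr_suml divff ?gt_eqF// -nu1 [X in X - _](bigID (fun i => nu i != 0)) /=.
by rewrite [X in _ + X - _]big1 ?addr0 ?subrr// => i /negPn/eqP.
Qed.

Section ClassFunctional.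
Variables (R : realType) (F : sgraph) (D : {set F} -> R).
Hypothesis D0 : D finset.set0 = 0.
Hypothesis D_aut : forall (f : {perm F}) (S : {set F}), automorphism f -> D (f @: S) = D S.

Let aut_equivP (S1 S2 : {set F}) :
  reflect (exists2 f : {perm F}, automorphism f & f @: S1 = S2) (aut_equiv S1 S2).
Proof.
apply: (iffP existsP) => [[f /andP[fa /eqP fS]]|[f fa fS]]; exists f => //.
by rewrite fa fS eqxx.
Qed.

Let aut_equiv_rel : equivalence_rel (@aut_equiv F).
Proof.
have autP (f : {perm F}) : reflect (forall x y, adj (f x) (f y) = adj x y) (automorphism f).
  by apply: (iffP forallP) => [H x y|H x]; [have /forallP/(_ y)/eqP := H x|
    apply/forallP => y; apply/eqP].
have sym (S1 S2 : {set F}) : aut_equiv S1 S2 -> aut_equiv S2 S1.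
  move=> /aut_equivP[f /autP fa fS]; apply/aut_equivP; exists (f^-1)%g.
    by apply/autP => x y; rewrite -fa !permKV.
  apply/setP => x; apply/imsetP/idP => [[y]|xS].
    by rewrite -fS => /imsetP[z zS ->] ->; rewrite permK.
  by exists (f x); rewrite ?permK// -fS imset_f.
have trans (S1 S2 S3 : {set F}) : aut_equiv S1 S2 -> aut_equiv S2 S3 -> aut_equiv S1 S3.
  move=> /aut_equivP[f /autP fa fS] /aut_equivP[g /autP ga gS]; apply/aut_equivP.
  exists (f * g)%g; first by apply/autP => x y; rewrite !permM ga fa.
  rewrite -gS -fS -imset_comp; apply: eq_imset => x; by rewrite permM.
move=> S1 S2 S3; split=> [|S12].
  apply/aut_equivP; exists 1%g; first by apply/autP => x y; rewrite !perm1.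
  by rewrite -[RHS]imset_id; apply: eq_imset => x; rewrite perm1.
by apply/idP/idP; [exact: trans (sym _ _ S12)|exact: trans S12].
Qed.

Let rep (C : aut_class F) : {set F} := odflt finset.set0 [pick S in val C].

(** The linear form that extends [D] from sets to vectors; [D_aut] makes the choice of
    representatives immaterial. *)
Definition class_functional (x : class_space R F) : R := \sum_C x C * D (rep C).

Lemma class_functional_evec S : class_functional (evec R S) = D S.
Proof.
rewrite /class_functional /evec; have [->|SN0] := eqVneq S finset.set0.
  by rewrite D0 big1// => C _; rewrite ffunE mul0r.
pose E := [set S : {set F} | S != finset.set0].
have parts : finset.partition (aut_classes F) E.
  by apply: equivalence_partitionP => x y z _ _ _; exact: aut_equiv_rel.
have triv := finset.partition_trivIset parts.
have SE : S \in E by rewrite inE.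
pose c := [set S' in E | aut_equiv S S'].
have cP : c \in aut_classes F by apply/imsetP; exists S.
have Sc : S \in c by rewrite inE SE (aut_equiv_rel S S S).1.
rewrite (bigD1 (exist _ c cP : aut_class F)) //= ffunE /= Sc mul1r big1 ?addr0.
  rewrite /rep; case: pickP => [S' /=|/(_ S)]; last by rewrite /= Sc.
  by rewrite inE => /andP[_ /aut_equivP[f fa <-]]; rewrite D_aut.
move=> C CN; rewrite ffunE; case SC: (S \in val C); last by rewrite mul0r.
case/eqP: CN; apply: val_inj => /=.
by rewrite -(finset.def_pblock triv (valP C) SC) (finset.def_pblock triv cP Sc).
Qed.

(** Applied to the identity that witnesses goodness, the functional turns its right-hand side into a
    nonnegative combination of nonpositive numbers. *)
Lemma class_functional_good (P : template F) :
  (forall R1 R2 R3, disjoint3 (R1, R2, R3) ->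
     D (R1 :|: R2 :|: R3) - D (R2 :|: R3) - D (R1 :|: R2) + D R2 <= 0) ->
  good R P ->
  (nedges (glued P))%:R / (nedges F)%:R * D [set: F] <=
  \sum_s D (psiV P s) - \sum_(e in edges (tree P)) D (psiE P e).
Proof.
move=> Dx [_ [c c_ge0 cE]].
have PhiD x y : class_functional (x + y) = class_functional x + class_functional y.
  by rewrite -big_split; apply: eq_bigr => C _; rewrite ffunE mulrDl.
have PhiZ a x : class_functional (a *: x) = a * class_functional x.
  by rewrite mulr_sumr; apply: eq_bigr => C _; rewrite ffunE mulrA.
have PhiN x : class_functional (- x) = - class_functional x.
  by rewrite -scaleN1r PhiZ mulN1r.
have Phi0 : class_functional 0 = 0 by rewrite -(scale0r 0) PhiZ mul0r.
have PhiS (I : finType) (Q : pred I) f :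
    class_functional (\sum_(i | Q i) f i) = \sum_(i | Q i) class_functional (f i).
  exact: (big_morph _ PhiD Phi0).
have := congr1 class_functional cE; rewrite PhiD PhiZ PhiN PhiD PhiN !PhiS.
rewrite class_functional_evec.
under eq_bigr do rewrite class_functional_evec.
under [X in _ - (_ - X)]eq_bigr do rewrite class_functional_evec.
move=> E; rewrite -subr_le0 E; apply: sumr_le0 => -[[R1 R2] R3] dR.
rewrite PhiZ mulr_ge0_le0// /xvec !PhiD !PhiN !class_functional_evec.
exact: Dx.
Qed.

End ClassFunctional.

(** * Densities of glued graphs *)

Lemma edge_prod_neq0 (R : realType) (U : Type) (w : U -> U -> R) (G : sgraph)
    (phi : G -> U) u v :
  (forall x y, w x y = w y x) ->
  edge_prod w phi != 0 -> adj u v -> w (phi u) (phi v) != 0.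
Proof.
move=> w_sym; rewrite edge_prodE -sqrf_eq0 edge_prod_on_sqr// => /prodf_neq0 H uv.
by apply: (H (u, v)); rewrite /= uv !inE.
Qed.

(** The symmetry of the cycle on which the entropy method rests: under an invariant law, all edges
    have the same expected log-weight. *)
Definition edge_transitive (F : sgraph) : Prop :=
  forall u v u' v' : F, adj u v -> adj u' v' ->
  exists2 f : {perm F}, automorphism f &
    (f u = u' /\ f v = v') \/ (f u = v' /\ f v = u').

Section EntropyMethod.
Variables (R : realType) (V : finType) (w : V -> V -> R) (F : sgraph).
Hypothesis V_gt0 : (0 < #|V|)%N.
Hypothesis w_sym : forall x y, w x y = w y x.
Hypothesis w_ge0 : forall x y, 0 <= w x y.
Hypothesis F_trans : edge_transitive F.
Hypothesis F_edges : (0 < nedges F)%N.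

Let Z : R := \sum_(phi : {ffun F -> V}) edge_prod w phi.
Let mu (phi : {ffun F -> V}) : R := edge_prod w phi / Z.
Hypothesis Z_gt0 : 0 < Z.

Let mu_ge0 phi : 0 <= mu phi.
Proof. by rewrite divr_ge0 ?(ltW Z_gt0)// edge_prodE edge_prod_on_ge0. Qed.

Let mu_sum1 : \sum_phi mu phi = 1.
Proof. by rewrite -mulr_suml divff// gt_eqF. Qed.

Let mu_neq0 phi : mu phi != 0 -> edge_prod w phi != 0.
Proof. by apply: contraNneq => H; rewrite /mu H mul0r. Qed.

Let comp (f : {perm F}) (phi : {ffun F -> V}) : {ffun F -> V} :=
  [ffun u => phi (f u)].

Let comp_inj f : injective (comp f).
Proof.
move=> phi psi /ffunP E; apply/ffunP => u.
by have := E (f^-1 u)%g; rewrite !ffunE permKV.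
Qed.

Let mu_comp f phi : automorphism f -> mu (comp f phi) = mu phi.
Proof.
move=> /forallP fa; rewrite /mu; congr (_ / _).
have fadj x y : adj (f x) (f y) = adj x y by have /forallP/(_ y)/eqP := fa x.
have fT : f @: [set: F] = [set: F].
  by apply/setP => x; rewrite !inE; apply/imsetP; exists (f^-1 x)%g; rewrite ?permKV.
rewrite [RHS]edge_prodE -fT -(edge_prod_embed w_sym w_ge0 phi (@perm_inj _ f) fadj).
by apply: eq_bigr => p _; rewrite /= !ffunE.
Qed.

Let ent_aut (f : {perm F}) (S : {set F}) :
  automorphism f -> ent mu (f @: S) = ent mu S.
Proof.
move=> fa; rewrite /ent [in RHS](reindex_inj (@comp_inj f)); congr (- _).
apply: eq_bigr => phi _; rewrite mu_comp//; congr (_ * ln _).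
rewrite /marg [in RHS](reindex_inj (@comp_inj f)); apply: eq_big => psi.
  apply/agreeP/agreeP => [H u uS|H u /imsetP[x xS ->]].
    by rewrite !ffunE H ?imset_f.
  by have := H x xS; rewrite !ffunE.
by rewrite mu_comp.
Qed.

Let L (u v : F) : R := \sum_phi mu phi * ln (w (phi u) (phi v)).

Let L_sym u v : L u v = L v u.
Proof. by apply: eq_bigr => phi _; rewrite w_sym. Qed.

Let L_aut f u v : automorphism f -> L (f u) (f v) = L u v.
Proof.
move=> fa; rewrite /L [in RHS](reindex_inj (@comp_inj f)).
by apply: eq_bigr => phi _; rewrite mu_comp// !ffunE.
Qed.

Let L_const u v u' v' : adj u v -> adj u' v' -> L u v = L u' v'.
Proof.
move=> uv uv'; have [f fa [[<- <-]|[<- <-]]] := F_trans uv uv'.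
  by rewrite L_aut.
by rewrite L_sym L_aut.
Qed.

(** The equality case of Gibbs' inequality: mu is proportional to the edge product, whose expected
    logarithm splits into one term [l] per edge. *)
Let ln_partition (l : R) : (forall u v, adj u v -> L u v = l) ->
  ln Z = ent mu [set: F] + (nedges F)%:R * l.
Proof.
move=> Ll.
have -> : ent mu [set: F] = - \sum_phi mu phi * (ln (edge_prod w phi) - ln Z).
  congr (- _); apply: eq_bigr => phi _.
  have [->|mu0] := eqVneq (mu phi) 0; first by rewrite !mul0r.
  have e0 := mu_neq0 mu0; congr (_ * _).
  rewrite -ln_div ?posrE//; last first.
    by rewrite lt_neqAle eq_sym e0 edge_prodE edge_prod_on_ge0.
  congr ln; rewrite /marg (big_pred1 phi)// => psi.
  apply/agreeP/eqP => [H|->//]; apply/ffunP => u; apply/esym/H; by rewrite inE.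
under eq_bigr do rewrite mulrBr.
rewrite sumrB -mulr_suml mu_sum1 mul1r opprB -addrA [X in _ + X](_ : _ = 0) ?addr0//.
apply/eqP; rewrite addrC subr_eq0; apply/eqP.
rewrite -card_oriented_edges mulr_natl -sumr_const.
rewrite (eq_bigr (fun phi => \sum_(p : F * F | adj p.1 p.2 && (enum_rank p.1 < enum_rank p.2)%N)
  mu phi * ln (w (phi p.1) (phi p.2)))) => [|phi _]; last first.
  have [->|mu0] := eqVneq (mu phi) 0.
    by rewrite mul0r big1// => p _; rewrite mul0r.
  rewrite -mulr_sumr; congr (_ * _); apply: ln_prod => p /andP[pa _].
  by rewrite lt_neqAle eq_sym w_ge0 (edge_prod_neq0 w_sym (mu_neq0 mu0)).
by rewrite exchange_big; apply/esym; apply: eq_bigr => p /andP[pa _]; rewrite -/(L _ _) Ll.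
Qed.

Variable P : template F.
Hypothesis P_good : good R P.
Local Notation T := (tree P).
Local Notation J := (glued P).

Lemma dens_glued_pos :
  dens w F ^+ nedges J <= dens w J ^+ nedges F.
Proof.
have /card_gt0P[v0 _] := V_gt0.
have [l Ll] : exists l, forall u v, adj u v -> L u v = l.
  have /card_gt0P[e /imsetP[[u v]]] := F_edges; rewrite inE /= => uv _.
  by exists (L u v) => u' v' uv'; exact: L_const.
have [nu [nu_ge0 nu_marg nu_supp nu_ent]] := exists_tree_law P v0 mu_ge0.
(* On the support of nu an array is constant on each class, so the picked representative does not
   matter. *)
pose theta (G : {ffun T * F -> V}) : {ffun J -> V} :=
  [ffun C : J => if [pick p in val C] is Some p then G p else v0].
have G_connect G p q : nu G != 0 -> connect (@identified F P) p q -> G p = G q.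
  move=> /nu_supp[_ Hc] /connectP[c]; elim: c p => [|r c IH] p /=; first by move=> _ ->.
  case/andP=> /and3P[pr /eqP E pe] rc qE; rewrite -(IH r rc qE).
  case: p r pr E pe {rc qE IH} => [s v] [t v'] /= st <- ve.
  by apply: Hc; rewrite ?inE.
have thetaE G (C : J) p : nu G != 0 -> p \in val C -> theta G C = G p.
  move=> nuG pC; rewrite ffunE; case: pickP => [q /= qC|/(_ p)]; last by rewrite /= pC.
  have /imsetP[r _ CE] := valP C.
  move: pC qC; rewrite /= CE !inE => /andP[_ rp] /andP[_ rq].
  by rewrite -(G_connect _ _ _ nuG rp) (G_connect _ _ _ nuG rq).
have classes_copies (C : J) p : p \in val C -> p \in copies P.
  by have /imsetP[r _ ->] := valP C; rewrite inE => /andP[].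
(* Off [copies] every array in the support equals [v0], so it can be recovered from its map on the
   glued graph, and no entropy is lost. *)
have theta_inj : {in [pred G | nu G != 0] &, injective theta}.
  move=> G G' nuG nuG' E; apply/ffunP => p.
  have [pc|pc] := boolP (p \in copies P); last first.
    have [H1 _] := nu_supp _ nuG; have [H2 _] := nu_supp _ nuG'.
    by rewrite H1 ?H2// inE /=; move: pc; rewrite inE.
  have CP : [set q in copies P | connect (@identified F P) p q] \in glued_classes P.
    by apply/imsetP; exists p.
  have pC : p \in val (exist (fun A => A \in glued_classes P) _ CP : J).
    by rewrite /= inE pc connect0.
  by rewrite -(thetaE _ _ _ nuG pC) E (thetaE _ _ _ nuG' pC).
(* Each edge of the glued graph comes from a single copy [s], so its expected log-weight can be
   computed from the marginal of nu at [s]. *)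
have edge_rep (A B : J) : adj A B -> exists s u v, [/\ adj u v,
    local (psiV P s) (fun phi => ln (w (phi u) (phi v))),
    local (psiV P s) (fun phi => (w (phi u) (phi v) == 0)%:R : R) &
    forall G, nu G != 0 -> w (theta G A) (theta G B) =
       w (row_at G s u) (row_at G s v)].
  case/existsP => s /existsP[u /existsP[v /and3P[sA sB uv]]]; exists s, u, v.
  have us : u \in psiV P s by have := classes_copies _ _ sA; rewrite inE.
  have vs : v \in psiV P s by have := classes_copies _ _ sB; rewrite inE.
  split=> //.
  - by move=> phi psi /agreeP H; rewrite !H.
  - by move=> phi psi /agreeP H; rewrite !H.
  - by move=> G nuG; rewrite (thetaE _ _ _ nuG sA) (thetaE _ _ _ nuG sB) !ffunE.
have w_gt0 G A B : nu G != 0 -> adj A B -> 0 < w (theta G A) (theta G B).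
  move=> nuG /edge_rep[s [u [v [uv _ loc ->]]]] //.
  rewrite lt_neqAle w_ge0 andbT eq_sym.
  have := nu_marg s _ (finset.in_setT _) loc; rewrite [RHS]big1 => [|phi _].
    move/eqP; rewrite psumr_eq0 => [|G' _]; last by rewrite mulr_ge0.
    move=> /allP/(_ G (mem_index_enum _)) /=; rewrite mulf_eq0 (negbTE nuG) /=.
    by rewrite pnatr_eq0 eqb0.
  have [->|mu0] := eqVneq (mu phi) 0; first by rewrite mul0r.
  by rewrite (negbTE (edge_prod_neq0 w_sym (mu_neq0 mu0) uv)) mulr0.
have nu_sum1 : \sum_G nu G = 1.
  have [T_gt0 _ _] := treeP P; have /card_gt0P[s _] := T_gt0.
  have := nu_marg s (fun=> 1) (finset.in_setT _) (fun _ _ _ => erefl).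
  by under eq_bigr do rewrite mulr1; move=> ->; under eq_bigr do rewrite mulr1.
have nuL : \sum_G nu G * ln (edge_prod w (theta G)) = (nedges J)%:R * l.
  rewrite -card_oriented_edges mulr_natl -sumr_const.
  rewrite (eq_bigr (fun G => \sum_(p : J * J | adj p.1 p.2 && (enum_rank p.1 < enum_rank p.2)%N)
    nu G * ln (w (theta G p.1) (theta G p.2)))) => [|G _]; last first.
    have [->|nu0] := eqVneq (nu G) 0.
      by rewrite mul0r big1// => p _; rewrite mul0r.
    rewrite -mulr_sumr; congr (_ * _); apply: ln_prod => p /andP[pa _].
    exact: w_gt0.
  rewrite exchange_big; apply: eq_bigr => p /andP[pa _].
  have [s [u [v [uv loc _ wE]]]] := edge_rep _ _ pa.
  rewrite -(Ll _ _ uv) /L -(nu_marg s _ (finset.in_setT _) loc).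
  apply: eq_bigr => G _; have [->|nu0] := eqVneq (nu G) 0; first by rewrite !mul0r.
  by rewrite wE.
set N := \sum_(th : {ffun J -> V}) edge_prod w th.
have ep_gt0 G : nu G != 0 -> 0 < edge_prod w (theta G).
  by move=> nuG; apply: prodr_gt0 => p /andP[pa _]; exact: w_gt0.
set N' := \sum_(G | nu G != 0) edge_prod w (theta G).
have N'_gt0 : 0 < N'.
  rewrite /N'; have [G nuG] : exists G, nu G != 0.
    apply/existsP; apply: contraT => /existsPn H; exfalso.
    have := nu_sum1; rewrite big1 => [/eqP|i _]; first by rewrite eq_sym oner_eq0.
    by apply/eqP; have := H i; rewrite negbK.
  by rewrite (bigD1 G)//= ltr_pwDl ?ep_gt0// sumr_ge0// => G' /andP[/ep_gt0/ltW].
have N'N : N' <= N.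
  have -> : N' = \sum_(G in [pred G | nu G != 0]) edge_prod w (theta G) by [].
  rewrite -(big_imset (fun th : {ffun J -> V} => edge_prod w th) theta_inj) /= /N.
  rewrite [X in _ <= X](bigID (mem (theta @: [pred G | nu G != 0]))) /= lerDl.
  by apply: sumr_ge0 => th _; rewrite edge_prodE edge_prod_on_ge0.
have N_gt0 := lt_le_trans N'_gt0 N'N.
have lnN : \sum_s ent mu (psiV P s) - \sum_(e in edges T) ent mu (psiE P e) +
    (nedges J)%:R * l <= ln N.
  apply: (@le_trans _ _ (ln N')); last by rewrite ler_ln ?posrE.
  apply: le_trans (gibbs nu_ge0 nu_sum1 ep_gt0).
  rewrite nuL nu_ent addrC lerD2l.
  rewrite [X in _ <= X - _](eq_bigl xpredT) => [|s]; last by rewrite inE.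
  by rewrite [X in _ <= _ - X](eq_bigl (mem (edges T))) => [|e]; rewrite ?finset.subsetT ?andbT.
pose k : R := ln #|V|%:R.
have k_ge0 : 0 <= k by rewrite ln_ge0// ler1n.
(* The functional suited to densities. Cardinality is additive on disjoint sets, so the new term
   cancels in the submodular inequality. *)
pose D (S : {set F}) : R := ent mu S - #|S|%:R * k.
have ZJ : ln (dens w J) = ln N - #|J|%:R * k.
  rewrite /dens /avg ln_div ?posrE// ?natrX ?exprn_gt0 ?ltr0n//.
  by rewrite lnXn ?ltr0n// mulr_natl.
have ZF : ln (dens w F) = D [set: F] + (nedges F)%:R * l.
  rewrite /dens /avg ln_div ?posrE// ?natrX ?exprn_gt0 ?ltr0n//.
  rewrite lnXn ?ltr0n// (ln_partition Ll) /D cardsT -[ln _ *+ _]mulr_natl.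
  by rewrite addrAC.
have gd : (nedges J)%:R / (nedges F)%:R * D [set: F] <=
    \sum_s D (psiV P s) - \sum_(e in edges T) D (psiE P e).
  apply: class_functional_good P_good.
  - by rewrite /D ent0// cards0 mul0r subr0.
  - by move=> f S fa; rewrite /D ent_aut// card_imset//; exact: perm_inj.
  - move=> R1 R2 R3 /and3P[/= d12 d13 d23].
    have := ent_submodular mu_ge0 mu_sum1 R1 R2 R3; rewrite /D.
    have c12 : #|R1 :|: R2| = (#|R1| + #|R2|)%N.
      by rewrite cardsU (eqP (_ : R1 :&: R2 == finset.set0)) ?cards0 ?subn0// finset.setI_eq0.
    have c23 : #|R2 :|: R3| = (#|R2| + #|R3|)%N.
      by rewrite cardsU (eqP (_ : R2 :&: R3 == finset.set0)) ?cards0 ?subn0// finset.setI_eq0.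
    have c123 : #|R1 :|: R2 :|: R3| = (#|R1| + #|R2| + #|R3|)%N.
      rewrite cardsU c12 (eqP (_ : (R1 :|: R2) :&: R3 == finset.set0)) ?cards0 ?subn0//.
      by rewrite finset.setIUl finset.setU_eq0 !finset.setI_eq0 d13 d23.
    rewrite c12 c23 c123 !natrD => H; apply: le_trans H; rewrite le_eqVlt.
    by apply/orP; left; apply/eqP; ring.
have cg := card_glued P.
have dJ_gt0 : 0 < dens w J by rewrite divr_gt0// natrX exprn_gt0// ltr0n.
have dF_gt0 : 0 < dens w F by rewrite divr_gt0// natrX exprn_gt0// ltr0n.
rewrite -ler_ln ?posrE ?exprn_gt0// !lnXn//.
rewrite -[ln _ *+ nedges J]mulr_natl -[ln _ *+ nedges F]mulr_natl ZJ ZF.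
have eF : 0 < (nedges F)%:R :> R by rewrite ltr0n.
have {}gd := ler_wpM2l (ltW eF) gd.
rewrite mulrA mulrCA mulfV ?gt_eqF// mulr1 in gd.
move: gd; rewrite /D !sumrB -!mulr_suml -!natr_sum => gd.
have cg' : #|J|%:R + (\sum_(e in edges T) #|psiE P e|)%:R <=
  (\sum_s #|psiV P s|)%:R :> R by rewrite -natrD ler_nat.
have {}cg' := ler_wpM2r k_ge0 cg'.
have H1 : \sum_s ent mu (psiV P s) - (\sum_s #|psiV P s|)%:R * k -
  (\sum_(e in edges T) ent mu (psiE P e) - (\sum_(e in edges T) #|psiE P e|)%:R * k) +
  (nedges J)%:R * l <= ln N - #|J|%:R * k.
  rewrite mulrDl in cg'; lra.
have {}H1 := ler_wpM2l (ltW eF) H1.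
apply: le_trans H1; rewrite mulrDr [X in _ <= X]mulrDr; apply: lerD => //.
by rewrite mulrCA.
Qed.

End EntropyMethod.

Lemma dens_glued (R : realType) (V : finType) (w : V -> V -> R) (F : sgraph)
    (P : template F) :
  (0 < #|V|)%N -> (forall x y, w x y = w y x) -> (forall x y, 0 <= w x y) ->
  edge_transitive F -> (0 < nedges F)%N -> good R P ->
  dens w F ^+ nedges (glued P) <= dens w (glued P) ^+ nedges F.
Proof.
move=> V0 ws w0 Ft Fe Pg.
(* If [Z] vanishes there is no law mu; the left-hand side is then 0, because goodness includes e(J)
   > 0. *)
have [Z0|ZN0] := eqVneq (\sum_(phi : {ffun F -> V}) edge_prod w phi) 0.
  have eJ_gt0 : (0 < nedges (glued P))%N by case: Pg.
  by rewrite /dens /avg Z0 mul0r expr0n gtn_eqF//= exprn_ge0// avg_ge0// => phi;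
    rewrite edge_prodE edge_prod_on_ge0.
apply: dens_glued_pos => //; rewrite lt_neqAle eq_sym ZN0 sumr_ge0// => phi _.
by rewrite edge_prodE edge_prod_on_ge0.
Qed.

(** Rotations suffice: every edge joins some i to its successor, and the two end points may be
    interchanged. *)
Lemma cycle_edge_transitive (m : nat) : (3 <= m)%N -> edge_transitive (cycle_graph m).
Proof.
move=> m3; have m0 : (0 < m)%N by apply: leq_trans m3.
pose rotf (k : nat) (i : 'I_m) : 'I_m := Ordinal (ltn_pmod (i + k) m0).
have rot_inj k : injective (rotf k).
  move=> i j /(congr1 val) /= /eqP; rewrite eqn_modDr !modn_small// => /eqP.
  exact: val_inj.
pose rot k : {perm cycle_graph m} := perm (@rot_inj k).
have rotS k i : rotf k (ordS i) = ordS (rotf k i).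
  by apply: val_inj; rewrite /= modnDml -[in RHS]addn1 modnDml addSn addn1.
have rot_aut k : automorphism (rot k).
  apply/forallP => x; apply/forallP => y; apply/eqP.
  have adjE (a b : cycle_graph m) : adj a b = (b == ordS a) || (a == ordS b).
    rewrite cycle_adjE//; congr (_ || _).
    by rewrite -(inj_eq (can_inj (@ordSK m))) ord_predK eq_sym.
  by rewrite !adjE !permE -!rotS !(inj_eq (@rot_inj k)).
(* Adding m - i instead of subtracting i avoids truncated subtraction. *)
have rot_to (i j : 'I_m) : rotf (j + (m - i))%N i = j.
  apply: val_inj; rewrite /= addnCA subnKC ?(ltnW (ltn_ord _))//.
  by rewrite modnDr modn_small.
have oriented (u v : cycle_graph m) : adj u v -> v = ordS u \/ u = ordS v.
  rewrite cycle_adjE// => /orP[/eqP|/eqP->]; first by left.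
  by right; rewrite ord_predK.
move=> u v u' v' /oriented[->|->] /oriented[->|->].
- exists (rot (u' + (m - u))%N) => //; left; by rewrite !permE rotS rot_to.
- exists (rot (v' + (m - u))%N) => //; right; by rewrite !permE rotS rot_to.
- exists (rot (u' + (m - v))%N) => //; right; by rewrite !permE rotS rot_to.
- exists (rot (v' + (m - v))%N) => //; left; by rewrite !permE rotS rot_to.
Qed.

(** * The inequality for finite weights *)

Section OneColour.
Variable R : realType.
Implicit Types (t c d p x y z : R) (e l m : nat).

(** AM-GM for [a] copies of [x], [b] copies of [y] and [n] ones. The hypothesis is in power form so
    that no roots appear. *)
Lemma weighted_amgm x y c a b n : 0 <= x -> 0 <= y -> 0 <= c ->
  (0 < a + b + n)%N -> c ^+ (a + b + n) <= x ^+ a * y ^+ b ->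
  (a + b + n)%:R * c <= a%:R * x + b%:R * y + n%:R.
Proof.
move=> x0 y0 c0 N0 le.
pose E (i : 'I_a + 'I_b + 'I_n) : R :=
  match i with inl (inl _) => x | inl (inr _) => y | inr _ => 1 end.
have E0 i : 0 <= E i by case: i => [[]|].
have cardE : #|{: 'I_a + 'I_b + 'I_n}| = (a + b + n)%N by rewrite !card_sum !card_ord.
have [/= H _] := leif_AGM (A := {: 'I_a + 'I_b + 'I_n}) (fun i _ => E0 i).
rewrite cardE !big_sumType /= !prodr_const !sumr_const !card_ord expr1n mulr1 in H.
have := le_trans le H; rewrite ler_pXn2r ?nnegrE//; last first.
  by rewrite divr_ge0// !addr_ge0// mulrn_wge0.
by rewrite ler_pdivlMr ?ltr0n// mulrC (mulr_natl x a) (mulr_natl y b).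
Qed.

Lemma bernoulli_ge0 z k : 0 <= z -> 1 + k%:R * (z - 1) <= z ^+ k.
Proof.
move=> z0; elim: k => [|k IH]; first by rewrite mul0r addr0.
rewrite exprS; apply: le_trans (ler_wpM2l z0 IH).
have : 0 <= k%:R * (z - 1) ^+ 2 :> R by rewrite mulr_ge0// sqr_ge0.
rewrite -natr1; lra.
Qed.

(* [c], [d] and [t] stand for the densities of the m-cycle, the edge and H. *)
Lemma one_colour_bound t c d p e l m : 0 <= t -> 0 <= c -> 0 <= d -> 0 < p ->
  (0 < m)%N -> (m <= e)%N ->
  c ^+ (e + l) <= (t * d ^+ l) ^+ m ->
  p / e%:R + (e + l)%:R / (e%:R * p ^+ m.-1) * (c - d ^+ m) / m%:R + (d - p) <=
  t / (e%:R * p ^+ e.-1).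
Proof.
move=> t0 c0 d0 p0 m0 me le.
have e0 := leq_trans m0 me.
have er : 0 < e%:R :> R by rewrite ltr0n.
have mr : 0 < m%:R :> R by rewrite ltr0n.
have pm := exprn_gt0 m p0; have pe := exprn_gt0 e p0.
(* Each density is divided by its value at constant weight [p], where the inequality is sharp. The e
   - m ones, available as m <= e, bring the total weight to e + l. *)
have := @weighted_amgm (t / p ^+ e) ((d / p) ^+ m) (c / p ^+ m) m l (e - m)%N.
have -> : (m + l + (e - m) = e + l)%N by lia.
rewrite !divr_ge0 ?exprn_ge0 ?divr_ge0 ?(ltW p0) ?(ltW pm) ?(ltW pe)//.
rewrite addn_gt0 e0 => /(_ isT isT isT isT) H.
have {H} AG : (e + l)%:R * (c / p ^+ m) <=
    m%:R * (t / p ^+ e) + l%:R * (d / p) ^+ m + (e - m)%:R.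
  apply: H; rewrite -exprM expr_div_n expr_div_n expr_div_n.
  rewrite mulf_div -!exprM -exprD -[(e * m + m * l)%N](_ : (m * (e + l))%N = _); last by lia.
  rewrite ler_pM2r ?invr_gt0 ?exprn_gt0//.
  by move: le; rewrite exprMn -exprM mulnC.
have B := @bernoulli_ge0 (d / p) m (divr_ge0 d0 (ltW p0)).
set z := (d / p) ^+ m in AG B.
have dz : d ^+ m = z * p ^+ m by rewrite /z expr_div_n divfK// gt_eqF.
have pmE : p ^+ m = p * p ^+ m.-1 by rewrite -exprS prednK.
have peE : p ^+ e = p * p ^+ e.-1 by rewrite -exprS prednK.
have pm1 : 0 < p ^+ m.-1 by rewrite exprn_gt0.
have pe1 : 0 < p ^+ e.-1 by rewrite exprn_gt0.
have [pN0 eN0 mN0 pmN0 peN0] : [/\ p != 0, e%:R != 0 :> R, m%:R != 0 :> R,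
    p ^+ m.-1 != 0 & p ^+ e.-1 != 0] by split; rewrite gt_eqF.
rewrite natrB// in AG.
have -> : t / (e%:R * p ^+ e.-1) = (p / (e%:R * m%:R)) * (m%:R * (t / p ^+ e)).
  by rewrite peE; field; rewrite pN0 eN0 mN0 peN0.
have q0 : 0 <= p / (e%:R * m%:R) by rewrite divr_ge0 ?mulr_ge0// ltW.
have {}AG := ler_wpM2l q0 AG.
have pB := ler_wpM2l (ltW p0) B.
have {pB} pB : (d - p) <= (p * z - p) / m%:R.
  rewrite ler_pdivlMr//.
  have -> : (d - p) * m%:R = p * (1 + m%:R * (d / p - 1)) - p by field.
  by rewrite lerD2r.
have E1 : p / (e%:R * m%:R) * ((e + l)%:R * (c / p ^+ m)) =
   (e + l)%:R / (e%:R * p ^+ m.-1) * c / m%:R.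
  by rewrite pmE; field; rewrite pN0 eN0 mN0 pmN0.
(* The factor (e + l) / e is split: its part l / e is the AM-GM term in [d], and the remaining p z /
   m is what Bernoulli's inequality bounds below. *)
have E2 : (e + l)%:R / (e%:R * p ^+ m.-1) * d ^+ m / m%:R =
   p / (e%:R * m%:R) * (l%:R * z) + p * z / m%:R.
  by rewrite dz pmE natrD; field; rewrite eN0 mN0 pmN0.
have E3 : p / (e%:R * m%:R) * (e%:R - m%:R) = p / m%:R - p / e%:R.
  by field; rewrite eN0 mN0.
rewrite mulrBr mulrBl E2; rewrite E1 mulrDr E3 [X in _ <= X + _]mulrDr in AG.
move: pB; rewrite mulrBl; lra.
Qed.

End OneColour.

Lemma finite_common (R : realType) (m : nat) (P1 P2 : template (cycle_graph m))
    (l1 l2 : nat) (H1 H2 : sgraph) (p1 p2 : R)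
    (n : nat) (w1 w2 : 'I_n.+1 -> 'I_n.+1 -> R) :
  (3 <= m)%N -> odd m -> good R P1 -> good R P2 ->
  obtained_by_deletion (glued P1) l1 H1 ->
  obtained_by_deletion (glued P2) l2 H2 ->
  (m <= nedges H1)%N -> (m <= nedges H2)%N ->
  0 < p1 -> 0 < p2 -> p1 + p2 = 1 ->
  (nedges H1 + l1)%:R / ((nedges H1)%:R * p1 ^+ m.-1) =
    (nedges H2 + l2)%:R / ((nedges H2)%:R * p2 ^+ m.-1) ->
  (forall x y, w1 x y = w1 y x) -> (forall x y, w2 x y = w2 y x) ->
  (forall x y, 0 <= w1 x y) -> (forall x y, 0 <= w2 x y) ->
  (forall x y, w1 x y + w2 x y = 1) ->
  p1 / (nedges H1)%:R + p2 / (nedges H2)%:R <=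
  dens w1 H1 / ((nedges H1)%:R * p1 ^+ (nedges H1).-1) +
  dens w2 H2 / ((nedges H2)%:R * p2 ^+ (nedges H2).-1).
Proof.
(* [k] is the coefficient common to both colours, [c] a cycle density and [x] the m-th power of an
   edge density [d]; the linear terms d - q sum to 0. *)
have arith (k c1 c2 x1 x2 d1 d2 q1 q2 a1 a2 : R) : 0 <= k ->
    x1 + x2 <= c1 + c2 -> d1 + d2 = 1 -> q1 + q2 = 1 ->
    a1 + a2 <= a1 + k * (c1 - x1) + (d1 - q1) + (a2 + k * (c2 - x2) + (d2 - q2)).
  move=> k0 cx d12 q12.
  have : 0 <= k * (c1 - x1 + (c2 - x2)) by rewrite mulr_ge0//; lra.
  by rewrite mulrDr; lra.
move=> m3 m_odd g1 g2 del1 del2 e1 e2 p1_gt0 p2_gt0 p12 bal s1 s2 w1_ge0 w2_ge0 w12.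
have m0 : (0 < m)%N by apply: leq_trans m3.
have V0 : (0 < #|'I_n.+1|)%N by rewrite card_ord.
have step (P : template (cycle_graph m)) (H : sgraph) l
    (w : 'I_n.+1 -> 'I_n.+1 -> R) : good R P -> obtained_by_deletion (glued P) l H ->
    (forall x y, w x y = w y x) -> (forall x y, 0 <= w x y) ->
    dens w (cycle_graph m) ^+ (nedges H + l) <=
    (dens w H * edge_dens w ^+ l) ^+ m :> R.
  move=> g del ws w0.
  have := dens_glued V0 ws w0 (cycle_edge_transitive m3) _ g.
  rewrite (nedges_cycle R m3) (nedges_deletion R del) (dens_deletion V0 ws w0 del).
  exact.
have B1 := one_colour_bound (dens_ge0 w1_ge0 H1) (dens_ge0 w1_ge0 _) (edge_dens_ge0 w1_ge0)
  p1_gt0 m0 e1 (step _ _ _ _ g1 del1 s1 w1_ge0).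
have B2 := one_colour_bound (dens_ge0 w2_ge0 H2) (dens_ge0 w2_ge0 _) (edge_dens_ge0 w2_ge0)
  p2_gt0 m0 e2 (step _ _ _ _ g2 del2 s2 w2_ge0).
have G := goodman_odd_cycle m3 m_odd s1 s2 w1_ge0 w2_ge0 w12.
have d12 : edge_dens w1 + edge_dens w2 = 1 := edge_densD V0 w12.
apply: le_trans (lerD B1 B2); rewrite bal.
set lam := (nedges H2 + l2)%:R / _.
have lam0 : 0 <= lam by rewrite divr_ge0// mulr_ge0// exprn_ge0// ltW.
rewrite (mulrAC lam (_ - _)) (mulrAC lam (dens w2 _ - _)).
apply: arith; [by rewrite divr_ge0|exact: G|exact: d12|exact: p12].
Qed.

(** * Marginals of the cube *)

Lemma prod_inj_extend (R : comNzRingType) (I J : finType) (h : I -> J)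
    (f : I -> R) (g : J -> R) : injective h ->
  (forall i, g (h i) = f i) -> (forall j, (forall i, h i != j) -> g j = 1) ->
  \prod_j g j = \prod_i f i.
Proof.
move=> h_inj gh g1; rewrite (bigID (fun j => j \in h @: [set: I])) /=.
rewrite [X in _ * X]big1 ?mulr1 => [|j hj]; last first.
  by apply: g1 => i; apply: contraNneq hj => <-; rewrite imset_f ?inE.
rewrite big_imset /= => [|i i' _ _ /h_inj//].
by apply: eq_big => i; rewrite ?inE// gh.
Qed.

Section CubeMarginals.
Local Open Scope classical_set_scope.
Variable R : realType.
Local Notation mR := (measurableTypeR R).
Local Notation lambda := (uniform_prob (@ltr01 R)).

Definition box n (B : 'I_n -> set mR) : set (n.-tuple mR) :=
  [set x | forall i, B i (tnth x i)].

Lemma measurable_box n (B : 'I_n -> set mR) :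
  (forall i, measurable (B i)) -> measurable (box B).
Proof.
move=> mB.
rewrite (_ : box B = \bigcap_(i in [set: 'I_n]) ((@tnth n mR)^~ i @^-1` B i)).
  apply: fin_bigcap_measurable; first exact: finite_finset.
  move=> i _; rewrite -[X in measurable X]setTI.
  exact: (@measurable_tnth _ mR n i).
by apply/seteqP; split=> [x Bx i _|x Bx i]; exact: Bx.
Qed.

Lemma cube_prob_box n (B : 'I_n -> set mR) : (forall i, measurable (B i)) ->
  cube_prob R n (box B) = (\prod_(i < n) fine (lambda (B i)))%:E.
Proof.
elim: n B => [|n IH] B mB.
  by rewrite big_ord0 /= diracE mem_set// => -[].
rewrite big_ord_recl /= /distribution /pushforward /=.
rewrite (_ : _ @^-1` _ = B ord0 `*` box (fun i => B (lift ord0 i))).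
  rewrite product_measure1E//; last by apply: measurable_box => i.
  transitivity (lambda (B ord0) *
      (\prod_(i < n) fine (lambda (B (lift ord0 i))))%:E)%E.
    by congr (_ * _)%E; exact: IH.
  by rewrite EFinM fineK// fin_num_measure.
apply/seteqP; split=> [[a x] Bx|[a x] [/= Ba Bx] i]; rewrite /tuple_cons /=.
  split=> /=; first by have := Bx ord0.
  by move=> i; have := Bx (lift ord0 i); rewrite tnthS.
by case: (unliftP ord0 i) => [j|] ->; [rewrite tnthS; exact: Bx|].
Qed.

(** Boxes are closed under intersection and their measure is an explicit product, so this generation
    property reduces equality of laws to boxes. *)
Lemma measurable_boxes n :
  @measurable _ (n.-tuple mR) =
  <<s [set box B | B in [set B : 'I_n -> set mR | forall i, measurable (B i)]] >>.
Proof.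
apply/seteqP; split; last first.
  apply: smallest_sub; first exact: sigma_algebra_measurable.
  by move=> _ [B mB <-]; exact: measurable_box.
apply: smallest_sub; first exact: smallest_sigma_algebra.
elim/big_ind: _ => [//|A B sA sB|i _ _ [C mC <-]]; first by rewrite subUset.
apply: sub_sigma_algebra.
exists (fun j => if j == i then C else setT); first by move=> j; case: ifP.
apply/seteqP; split=> [x Bx|x [_ Cx] j].
  by split=> //; have := Bx i; rewrite eqxx.
by case: ifP => // /eqP->.
Qed.

Section Selection.
Variables (k n : nat) (h : 'I_k -> 'I_n).

Definition tuple_sel (x : n.-tuple mR) : k.-tuple mR := [tuple tnth x (h j) | j < k].

Lemma measurable_tuple_sel : measurable_fun setT tuple_sel.
Proof.
apply/measurable_fun_tnthP => j.
rewrite (_ : _ \o _ = (@tnth n mR)^~ (h j)); first exact: measurable_tnth.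
by apply/funext => x /=; rewrite tnth_mktuple.
Qed.

HB.instance Definition _ :=
  isMeasurableFun.Build _ _ _ _ tuple_sel measurable_tuple_sel.

Hypothesis h_inj : injective h.

(** The preimage of a box under an injective selection is again a box; its unselected coordinates
    are free and contribute factors 1. *)
Lemma cube_prob_sel (A : set (k.-tuple mR)) : measurable A ->
  distribution (cube_prob R n) tuple_sel A = cube_prob R k A.
Proof.
apply: (measure_unique [set box B | B in [set B : 'I_k -> set mR | forall i, measurable (B i)]]
  (fun=> setT)).
- exact: measurable_boxes.
- move=> _ _ [B mB <-] [C mC <-]; exists (fun i => B i `&` C i).
    by move=> i; apply: measurableI.
  apply/seteqP; split=> [x H|x [H1 H2] i].
    by split=> i; have [] := H i.
  by split.
- move=> _; exists (fun=> setT) => //.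
  by apply/seteqP.
- by rewrite bigcup_const.
- move=> _ [B mB <-]; apply: eq_trans (esym (cube_prob_box mB)).
  pose C (i : 'I_n) : set mR := if [pick j | h j == i] is Some j then B j else setT.
  have Ch j : C (h j) = B j.
    by rewrite /C; case: pickP => [j' /eqP/h_inj->//|/(_ j)]; rewrite eqxx.
  have mC i : measurable (C i) by rewrite /C; case: pickP.
  have selE : tuple_sel @^-1` box B = box C.
    apply/seteqP; split=> [x Bx i|x Cx j].
      rewrite /C; case: pickP => [j /eqP <-|//].
      by have := Bx j; rewrite tnth_mktuple.
    by rewrite tnth_mktuple -Ch; exact: Cx.
  transitivity (cube_prob R n (tuple_sel @^-1` box B)); first by [].
  rewrite selE cube_prob_box//; congr (_%:E).
  apply: (prod_inj_extend h_inj) => [j|i hi]; first by rewrite Ch.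
  rewrite /C; case: pickP => [j /eqP hj|_]; first by have := hi j; rewrite hj eqxx.
  by rewrite probability_setT.
- move=> _; apply: (le_lt_trans _ (ltry 1)).
  exact: (@probability_le1 _ _ _ (distribution (cube_prob R n) tuple_sel)).
Qed.

Lemma integral_cube_sel (f : k.-tuple mR -> R) :
  measurable_fun [set: k.-tuple mR] f -> (forall y, 0 <= f y) ->
  (\int[cube_prob R n]_x (f (tuple_sel x))%:E = \int[cube_prob R k]_y (f y)%:E)%E.
Proof.
move=> mf f0.
transitivity (\int[distribution (cube_prob R n) tuple_sel]_y (f y)%:E)%E.
  rewrite ge0_integral_distribution//; exact/measurable_EFinP.
by apply: eq_measure_integral => A mA _; exact: cube_prob_sel.
Qed.

End Selection.

End CubeMarginals.

(** * Sampling from a graphon *)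

Lemma ffact_le_exp (n k : nat) : (n ^_ k <= n ^ k)%N.
Proof.
elim: k => // k IH; rewrite ffactnSr expnSr.
by apply: leq_mul => //; exact: leq_subr.
Qed.

(** The step from k to k + 1 adds k to the error coefficient, and k^2 + k <= (k + 1)^2. Divided by n
    ^ k.+1, this bounds the proportion of non-injective maps by k^2 / n. *)
Lemma exp_le_ffact (k n : nat) : (n * n ^ k <= n * n ^_ k + k ^ 2 * n ^ k)%N.
Proof.
elim: k => [|k IH]; first by rewrite ffactn0 expn0 addn0.
rewrite ffactnSr expnS.
have := ffact_le_exp n k; move: IH; move: (n ^_ k) (n ^ k)%N => X Y IH XY.
have nk : (n * X <= X * (n - k) + k * Y)%N.
  apply: (@leq_trans (X * (n - k) + k * X)); last by rewrite leq_add2l leq_mul.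
  by rewrite [(k * X)%N]mulnC -mulnDr mulnC leq_mul2l; apply/orP; right; lia.
have {}nk := leq_mul (leqnn n) nk; have {}IH := leq_mul (leqnn n) IH.
rewrite mulnDr in nk; rewrite mulnDr in IH.
apply: leq_trans IH _; apply: leq_trans (leq_add nk (leqnn _)) _.
rewrite -addnA leq_add2l -[k.+1]addn1 sqrnD; nia.
Qed.

Section BoundedIntegrals.
Local Open Scope classical_set_scope.
Context (d : measure_display) (T : measurableType d) (R : realType).
Variables (P : probability T R) (D : set T).
Hypothesis mD : measurable D.

Lemma integrable_unit_valued (f : T -> R) : measurable_fun D f ->
  (forall x, 0 <= f x <= 1) -> P.-integrable D (EFin \o f).
Proof.
move=> mf f01; apply: measurable_bounded_integrable => //.
  by rewrite (le_lt_trans (probability_le1 P mD))// ltry.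
exists 1; split; first exact: num_real.
move=> M M1 x _; have /andP[f0 f1] := f01 x.
by rewrite /= ger0_norm// (le_trans f1)// ltW.
Qed.

Lemma Rintegral_sum (I : finType) (f : I -> T -> R) :
  (forall i, P.-integrable D (EFin \o f i)) ->
  \int[P]_(x in D) (\sum_i f i x) = \sum_i \int[P]_(x in D) f i x.
Proof.
move=> fi; rewrite /Rintegral.
under eq_integral do rewrite -sumEFin.
rewrite (integral_sum mD fi) sum_fine// => i _.
exact: (integrable_fin_num mD (fi i)).
Qed.

Lemma integrable_Rsum (I : finType) (f : I -> T -> R) :
  (forall i, P.-integrable D (EFin \o f i)) ->
  P.-integrable D (EFin \o (fun x => \sum_i f i x)).
Proof.
move=> fi; rewrite (_ : _ \o _ = (fun x => \sum_i (f i x)%:E)%E).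
  by apply: (integrable_sum mD) => i _; exact: fi.
by apply/funext => x /=; rewrite sumEFin.
Qed.

End BoundedIntegrals.

Section Sampling.
Local Open Scope classical_set_scope.
Variable R : realType.
Local Notation mR := (measurableTypeR R).

Definition unit_cube n : set (n.-tuple mR) := [set x | forall i, 0 <= tnth x i <= 1].
Arguments unit_cube : clear implicits.

Lemma unit_cubeE n : unit_cube n = box (fun=> `[0, 1]).
Proof.
by apply/seteqP; split=> x H i; have := H i; rewrite /= in_itv.
Qed.

Lemma measurable_unit_cube n : measurable (unit_cube n).
Proof. by rewrite unit_cubeE; apply: measurable_box => i; exact: measurable_itv. Qed.

Lemma cube_prob_unit_cube n : cube_prob R n (unit_cube n) = 1%E.
Proof.
rewrite unit_cubeE cube_prob_box; last by move=> i; exact: measurable_itv.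
by rewrite big1// => i _; rewrite /uniform_prob integral_uniform_pdf1.
Qed.

Lemma Rintegral_unit_cube_cst n (c : R) :
  \int[cube_prob R n]_(x in unit_cube n) c = c.
Proof.
rewrite Rintegral_cst; last exact: measurable_unit_cube.
have E : fine (cube_prob R n (unit_cube n)) = 1 by rewrite cube_prob_unit_cube.
by rewrite -[RHS]mulr1 -[in RHS]E.
Qed.

Lemma integral_unit_cube n (f : n.-tuple mR -> R) :
  measurable_fun [set: n.-tuple mR] f -> (forall x, 0 <= f x) ->
  (\int[cube_prob R n]_(x in unit_cube n) (f x)%:E =
   \int[cube_prob R n]_x (f x)%:E)%E.
Proof.
move=> mf f0; have mC := @measurable_unit_cube n.
rewrite [RHS](@ge0_negligible_integral _ _ _ _ _ (~` unit_cube n))//.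
- by rewrite setTD setCK.
- exact: measurableC.
- exact/measurable_EFinP.
- by move=> x _; rewrite lee_fin.
- have := probability_setC (cube_prob R n) mC.
  by rewrite cube_prob_unit_cube subee.
Qed.

Variable W : mR * mR -> R.
Hypothesis W_graphon : graphon W.

(* Truncation makes W measurable on the whole plane. *)
Definition clip (z : mR * mR) : R :=
  Num.max 0 (Num.min 1 ((W \_ (@unit_square R)) z)).

Lemma clip_ge0 z : 0 <= clip z.
Proof. by rewrite le_max lexx. Qed.

Lemma clip_le1 z : clip z <= 1.
Proof. by rewrite ge_max ler01 ge_min lexx. Qed.

Lemma clipE z : unit_square z -> clip z = W z.
Proof.
move=> Sz; have [_ _ /(_ z Sz)/andP[W0 W1]] := W_graphon.
by rewrite /clip patchE mem_set// (min_idPr W1) (max_idPr W0).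
Qed.

Lemma clip_sym a b : clip (a, b) = clip (b, a).
Proof.
have [_ sym _] := W_graphon.
have [Sab|Sab] := pselect (unit_square (a, b)).
  by rewrite !clipE//; [exact: sym|case: Sab].
rewrite /clip !patchE !memNset// => -[Sb Sa]; exact: Sab.
Qed.

Lemma measurable_clip : measurable_fun setT clip.
Proof.
have [mW _ _] := W_graphon.
have mS : measurable (@unit_square R).
  by apply: measurableX; exact: measurable_itv.
apply: measurable_maxr; first exact: measurable_cst.
apply: measurable_minr; first exact: measurable_cst.
exact/(measurable_restrictT W mS).
Qed.

(** The diagonal is not set to 0, so that the samples of two complementary graphons add up to 1 at
    every pair of indices. *)
Definition sample_weight n (x : n.-tuple mR) (i j : 'I_n) : R :=
  clip (tnth x i, tnth x j).

Definition sample_mean (G : sgraph) n (phi : G -> 'I_n) : R :=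
  \int[cube_prob R n]_(x in unit_cube n) edge_prod (sample_weight x) phi.

Lemma edge_prod_sample01 (G : sgraph) n (phi : G -> 'I_n) (x : n.-tuple mR) :
  0 <= edge_prod (sample_weight x) phi <= 1.
Proof.
apply/andP; split; first by apply: prodr_ge0 => p _; exact: clip_ge0.
by apply: prodr_ile1 => p _; rewrite clip_ge0 clip_le1.
Qed.

Lemma measurable_edge_prod (G : sgraph) n (phi : G -> 'I_n) :
  measurable_fun [set: n.-tuple mR]
    (fun x => edge_prod (sample_weight x) phi).
Proof.
rewrite /edge_prod; under eq_fun do rewrite -big_filter.
apply: measurable_prod => p _.
apply: (@measurableT_comp _ _ _ _ _ _ clip); first exact: measurable_clip.
by apply: measurable_fun_pair; exact: measurable_tnth.
Qed.

Lemma integrable_edge_prod (G : sgraph) n (phi : G -> 'I_n) :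
  (cube_prob R n).-integrable (unit_cube n)
    (EFin \o (fun x => edge_prod (sample_weight x) phi)).
Proof.
apply: integrable_unit_valued; first exact: measurable_unit_cube.
  by apply: measurable_funTS; exact: measurable_edge_prod.
exact: edge_prod_sample01.
Qed.

Lemma sample_mean_le1 (G : sgraph) n (phi : G -> 'I_n) : sample_mean phi <= 1.
Proof.
have mC := @measurable_unit_cube n.
rewrite -[X in _ <= X](Rintegral_unit_cube_cst n).
apply: le_Rintegral => //; first exact: integrable_edge_prod.
  by apply: integrable_unit_valued => // x; rewrite ler01 lexx.
by move=> x _; case/andP: (edge_prod_sample01 phi x).
Qed.

(** An injective [phi] reads distinct coordinates of the sample, which are independent and uniform;
    the other coordinates integrate out. *)
Lemma sample_mean_inj (G : sgraph) n (phi : G -> 'I_n) : injective phi ->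
  sample_mean phi = hom_density G W.
Proof.
move=> phi_inj.
pose f (y : #|G|.-tuple mR) := edge_prod (sample_weight y) (@enum_rank G).
have mf : measurable_fun [set: #|G|.-tuple mR] f by exact: measurable_edge_prod.
have f0 y : 0 <= f y by case/andP: (edge_prod_sample01 (@enum_rank G) y).
transitivity (\int[cube_prob R #|G|]_(y in unit_cube #|G|) f y); last first.
  apply: eq_Rintegral => y /set_mem yC; apply: eq_bigr => p _.
  by rewrite /sample_weight clipE//; split; rewrite /= in_itv; exact: yC.
pose h (j : 'I_#|G|) := phi (enum_val j).
have h_inj : injective h by move=> j j' /phi_inj/enum_val_inj.
rewrite /sample_mean /Rintegral; congr fine.
rewrite !integral_unit_cube//; last 2 first.
- exact: measurable_edge_prod.
- by move=> x; case/andP: (edge_prod_sample01 phi x).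
rewrite -(integral_cube_sel h_inj mf f0); apply: eq_integral => x _; congr (_%:E).
apply: eq_bigr => p _.
by rewrite /sample_weight !tnth_mktuple /h !enum_rankK.
Qed.

Lemma hom_density_ge0 (G : sgraph) : 0 <= hom_density G W.
Proof.
rewrite -(sample_mean_inj (@enum_rank_inj G)); apply: Rintegral_ge0 => x _.
by case/andP: (edge_prod_sample01 (@enum_rank G) x).
Qed.

Lemma integrable_dens_sample (G : sgraph) n :
  (cube_prob R n).-integrable (unit_cube n)
    (EFin \o (fun x => \sum_(phi : {ffun G -> 'I_n}) edge_prod (sample_weight x) phi)).
Proof.
apply: integrable_Rsum; first exact: measurable_unit_cube.
by move=> phi; exact: integrable_edge_prod.
Qed.

Lemma integral_dens_sample (G : sgraph) n :
  \int[cube_prob R n.+1]_(x in unit_cube n.+1) dens (sample_weight x) G <=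
  hom_density G W + (#|G| ^ 2)%:R / n.+1%:R.
Proof.
have mC := @measurable_unit_cube n.+1.
rewrite /dens /avg card_ord RintegralZr//; last exact: integrable_dens_sample.
rewrite Rintegral_sum//; last by move=> phi; exact: integrable_edge_prod.
set k := #|G|; set N := n.+1.
pose I := [set phi : {ffun G -> 'I_N} | injectiveb phi]%SET.
have cI : #|I| = (N ^_ k)%N by rewrite /I card_inj_ffuns card_ord.
have Nk : 0 < (N ^ k)%:R :> R by rewrite ltr0n expn_gt0.
rewrite ler_pdivrMr// (bigID (mem I)) /=.
have -> : \sum_(phi in I) sample_mean phi = (N ^_ k)%:R * hom_density G W.
  rewrite (eq_bigr (fun=> hom_density G W)) => [|phi]; last first.
    by rewrite inE => /injectiveP/sample_mean_inj.
  by rewrite sumr_const cI mulr_natl.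
have le1 : \sum_(phi : {ffun G -> 'I_N} | phi \notin I) sample_mean phi <=
    (N ^ k)%:R - (N ^_ k)%:R.
  apply: (@le_trans _ _ (\sum_(phi : {ffun G -> 'I_N} | phi \notin I) 1)).
    by apply: ler_sum => phi _; exact: sample_mean_le1.
  rewrite sumr_const (_ : #|_| = (N ^ k - N ^_ k)%N); last first.
    have := cardC I; rewrite card_ffun card_ord cI => <-.
    by rewrite addKn; apply: eq_card => phi.
  by rewrite natrB// ffact_le_exp.
have ff : (N ^_ k)%:R <= (N ^ k)%:R :> R by rewrite ler_nat ffact_le_exp.
apply: le_trans (lerD (ler_wpM2r (hom_density_ge0 G) ff) le1) _.
rewrite mulrDl mulrC lerD2l.
rewrite mulrAC ler_pdivlMr ?ltr0n// mulrBl lerBlDl -!natrM -natrD ler_nat.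
by rewrite mulnC (mulnC (N ^_ k)%N) exp_le_ffact.
Qed.

Lemma integrable_dens (G : sgraph) n :
  (cube_prob R n).-integrable (unit_cube n)
    (EFin \o (fun x => dens (sample_weight x) G)).
Proof.
have mC := @measurable_unit_cube n.
exact: (integrableZr mC (#|'I_n| ^ #|G|)%:R^-1 (integrable_dens_sample G n)).
Qed.

End Sampling.

Lemma ler_of_natdiv (R : realType) (a b c : R) :
  (forall n : nat, a <= b + c / n.+1%:R) -> a <= b.
Proof.
move=> H; rewrite leNgt; apply/negP => ba.
have ab : 0 < a - b by rewrite subr_gt0.
have c_ge0 n : (a - b) * n.+1%:R <= c.
  by rewrite -ler_pdivlMr ?ltr0n// lerBlDl H.
have c0 : 0 <= c by apply: le_trans (c_ge0 0%N); rewrite mulr1 ltW.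
have := archi_boundP (divr_ge0 c0 (ltW ab)).
set n := Num.bound _ => cn; have := c_ge0 n; apply/negP; rewrite -ltNge.
rewrite ltr_pdivrMr// in cn; apply: (lt_trans cn); rewrite mulrC.
by rewrite ltr_pM2l// ltr_nat.
Qed.


Theorem theorem6p1 (R : realType) (m : nat) (m_ge3 : (3 <= m)%N) (m_odd : odd m)
  (P1 P2 : template (cycle_graph m))
  (good1 : good R P1) (good2 : good R P2)
  (l1 l2 : nat) (H1 H2 : sgraph)
  (H1_del : obtained_by_deletion (glued P1) l1 H1)
  (H2_del : obtained_by_deletion (glued P2) l2 H2)
  (H1_edges : (m <= nedges H1)%N) (H2_edges : (m <= nedges H2)%N)
  (p1 p2 : R) (p1_01 : 0 < p1 < 1) (p2_01 : 0 < p2 < 1) (p12 : p1 + p2 = 1)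
  (balance :
    (nedges H1 + l1)%:R / ((nedges H1)%:R * p1 ^+ m.-1) =
    (nedges H2 + l2)%:R / ((nedges H2)%:R * p2 ^+ m.-1)) :
  common p1 p2 H1 H2.
Proof.
have m_gt0 : (0 < m)%N by apply: leq_trans m_ge3.
have /andP[p1_gt0 _] := p1_01; have /andP[p2_gt0 _] := p2_01.
split; [exact: leq_trans H1_edges|exact: leq_trans H2_edges|].
move=> W1 W2 gW1 gW2 W12.
set b1 := (nedges H1)%:R * p1 ^+ _; set b2 := (nedges H2)%:R * p2 ^+ _.
have b1_ge0 : 0 <= b1^-1 by rewrite invr_ge0 mulr_ge0// exprn_ge0// ltW.
have b2_ge0 : 0 <= b2^-1 by rewrite invr_ge0 mulr_ge0// exprn_ge0// ltW.
(* The sampling errors of the two densities, weighted by their coefficients; [K] is independent of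
   the sample size, so K / n.+1 disappears in the limit. *)
pose K : R := (#|H1| ^ 2)%:R / b1 + (#|H2| ^ 2)%:R / b2.
apply: (@ler_of_natdiv _ _ _ K) => n.
pose f W H x := @dens R 'I_n.+1 (sample_weight W x) H.
have mC := @measurable_unit_cube R n.+1.
have i1 := integrable_dens gW1 H1 n.+1.
have i2 := integrable_dens gW2 H2 n.+1.
have ib1 := integrableZr mC b1^-1 i1; have ib2 := integrableZr mC b2^-1 i2.
rewrite -[X in X <= _](Rintegral_unit_cube_cst n.+1).
apply: (@le_trans _ _ (\int[cube_prob R n.+1]_(x in @unit_cube R n.+1)
    (f W1 H1 x / b1 + f W2 H2 x / b2))).
  apply: le_Rintegral => //.
  - exact: finite_measure_integrable_cst.
  - exact: (integrableD mC ib1 ib2).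
  move=> x xC.
  have inS i j : unit_square (tnth x i, tnth x j).
    by split; rewrite /= in_itv; exact: xC.
  apply: (finite_common (m := m) (P1 := P1) (P2 := P2) (l1 := l1) (l2 := l2)) => //.
  - by move=> i j; exact: clip_sym.
  - by move=> i j; exact: clip_sym.
  - by move=> i j; exact: clip_ge0.
  - by move=> i j; exact: clip_ge0.
  - by move=> i j; rewrite /sample_weight !clipE// W12.
rewrite RintegralD// (RintegralZr _ mC i1) (RintegralZr _ mC i2).
have e1 := ler_wpM2r b1_ge0 (integral_dens_sample gW1 H1 n).
have e2 := ler_wpM2r b2_ge0 (integral_dens_sample gW2 H2 n).
apply: le_trans (lerD e1 e2) _; rewrite /K.
rewrite le_eqVlt; apply/orP; left; apply/eqP; ring.
Qed.
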